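(* Let $\mathbb{G}$ be a homogeneous group of homogeneous dimension $Q$ and let $|\cdot|$ be a homogeneous quasi-norm on $\mathbb{G}$. Let $0<\gamma<Q$, $1<p<\frac{Q}{\gamma}$, $1<p<q<\infty$, $0<\lambda<Q-\gamma p$ and $\frac1q=\frac1p-\frac{\gamma}{Q-\lambda}$. Then there is a positive constant $C$, independent of $u$, such that for all $u\in M^\lambda_p(\mathbb{G})$, $$\|I_{\gamma}u\|_{M^{\lambda}_{q}(\mathbb{G})}\le C\|u\|_{M^{\lambda}_{p}(\mathbb{G})}.$$
   Context: A homogeneous group $\mathbb{G}$ is a Lie group on $\mathbb{R}^N$ equipped with dilations $D_t(x)=(t^{\nu_1}x_1,\dots,t^{\nu_N}x_N)$, $\nu_1,\dots,\nu_N>0$, that are automorphisms of $\mathbb{G}$ for each $t>0$; one writes $tx$ for $D_t(x)$. Its homogeneous dimension is $Q=\nu_1+\dots+\nu_N$. The Haar measure $dx$ is Lebesgue measure. A homogeneous quasi-norm is a continuous function $|\cdot|:\mathbb{G}\to[0,\infty)$ with $|x^{-1}|=|x|$, $|tx|=t|x|$ for $t>0$, and $|x|=0$ iff $x$ is the identity. Quasi-balls are $B(x,R)=\{y\in\mathbb{G}:|x^{-1}y|<R\}$. For $1<p<\infty$ and $0<\lambda<Q$, the global Morrey space $M^\lambda_p(\mathbb{G})$ consists of $f\in L^p_{\rm loc}(\mathbb{G})$ with finite norm given by $\|f\|^p_{M^\lambda_p(\mathbb{G})}=\sup_{x\in\mathbb{G}}\sup_{r>0}r^{-\lambda}\int_{B(x,r)}|f(y)|^p\,dy$.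 The Riesz potential is $I_\gamma u(x)=\int_{\mathbb{G}}|y^{-1}x|^{\gamma-Q}u(y)\,dy$ for $0<\gamma<Q$. *)

(* Defs.v *)
From HB Require Import structures.
From mathcomp Require Import all_boot all_order all_algebra.
From mathcomp Require Import all_classical all_reals all_analysis.
From mathcomp Require Import measurable_realfun.

Set Implicit Arguments.
Unset Strict Implicit.
Unset Printing Implicit Defensive.

Import Order.TTheory GRing.Theory Num.Theory.
Import numFieldNormedType.Exports.

Local Open Scope classical_set_scope.
Local Open Scope ring_scope.

(* R^N is 'rV[R]_N, with the product of the Borel sigma-algebras of the
   coordinates, as the library does for N.-tuple R. It coincides with the Borel
   sigma-algebra of the topology of 'rV[R]_N. *)
Section measurable_rV.
Context {R : realType} {N : nat}.

Definition rV_coord (i : 'I_N) (x : 'rV[R]_N) : R := x ord0 i.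

Let rV_set0 : g_sigma_preimage rV_coord set0.
Proof. exact: sigma_algebra0. Qed.

Let rV_setC A : g_sigma_preimage rV_coord A -> g_sigma_preimage rV_coord (~` A).
Proof. exact: sigma_algebraC. Qed.

Let rV_bigcup (F : (set 'rV[R]_N)^nat) :
  (forall i, g_sigma_preimage rV_coord (F i)) ->
  g_sigma_preimage rV_coord (\bigcup_i (F i)).
Proof. exact: sigma_algebra_bigcup. Qed.

HB.instance Definition _ := @isMeasurable.Build default_measure_display
  'rV[R]_N (g_sigma_preimage rV_coord) rV_set0 rV_setC rV_bigcup.

End measurable_rV.

Lemma measurable_rV_coord (R : realType) N (i : 'I_N) :
  measurable_fun [set: 'rV[R]_N] (rV_coord i).
Proof.
move=> _ Y mY; rewrite setTI; apply: sub_sigma_algebra => /=.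
rewrite -bigcup_seq/=; exists i => /=; first by rewrite mem_index_enum.
by exists Y => //; rewrite setTI.
Qed.

Lemma measurable_fun_rVP d (T : measurableType d) (R : realType) N
    (f : T -> 'rV[R]_N) :
  (forall i, measurable_fun [set: T] (rV_coord i \o f)) ->
  measurable_fun [set: T] f.
Proof.
move=> mf _ A mA; rewrite setTI.
suff : (@measurable _ 'rV[R]_N) `<=`
    image_set_system setT f (@measurable _ T).
  by move=> /(_ A mA); rewrite /image_set_system/= setTI.
apply: smallest_sub.
  by apply: sigma_algebra_image; exact: sigma_algebra_measurable.
case: N => [|N] in f mf A mA *; first by rewrite big_ord0.
rewrite -bigcup_mkord_ord; apply: bigcup_sub => i Ii.
move=> B [C mC <-]; rewrite /image_set_system/=.
have := mf (inord i) measurableT C mC.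
by rewrite !setTI.
Qed.

Definition cons_rV (R : realType) n (z : R * 'rV[R]_n) : 'rV[R]_n.+1 :=
  row_mx (z.1)%:M z.2.

Lemma measurable_cons_rV (R : realType) n :
  measurable_fun setT (@cons_rV R n).
Proof.
apply: measurable_fun_rVP => i.
case: (@splitP 1 n i) => [j ij|k ik].
  have -> : rV_coord i \o @cons_rV R n = fst.
    apply/funext => z /=; rewrite /rV_coord /cons_rV.
    have -> : i = @lshift 1 n j by exact/val_inj.
    by apply: etrans (row_mxEl _ _ _ _) _; rewrite mxE (ord1 j).
  exact: measurable_fst.
have -> : rV_coord i \o @cons_rV R n = rV_coord k \o snd.
  apply/funext => z /=; rewrite /rV_coord /cons_rV.
  have -> : i = @rshift 1 n k by exact/val_inj.
  exact: row_mxEr.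
by apply: measurableT_comp; [exact: measurable_rV_coord|exact: measurable_snd].
Qed.

Section lebesgue_rV_step.
Local Open Scope ereal_scope.
Context {R : realType} {n : nat}.
Variable mu : {sigma_finite_measure set 'rV[R]_n -> \bar R}.

Definition lebesgue_rV_step : set 'rV[R]_n.+1 -> \bar R :=
  pushforward (@lebesgue_measure R \x mu) (@cons_rV R n).

Let lebesgue_rV_step0 : lebesgue_rV_step set0 = 0.
Proof. by rewrite /lebesgue_rV_step /pushforward preimage_set0 measure0. Qed.

Let lebesgue_rV_step_ge0 A : 0 <= lebesgue_rV_step A.
Proof. by apply: measure_ge0; exact: measurable_cons_rV. Qed.

Let lebesgue_rV_step_sigma_additive : semi_sigma_additive lebesgue_rV_step.
Proof.
apply: measure_semi_sigma_additive.
exact: measurable_cons_rV.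
Qed.

HB.instance Definition _ := isMeasure.Build _ _ _ lebesgue_rV_step
  lebesgue_rV_step0 lebesgue_rV_step_ge0 lebesgue_rV_step_sigma_additive.

Let uncons_rV (v : 'rV[R]_n.+1) : R * 'rV[R]_n :=
  (v ord0 ord0, rsubmx (v : 'rV_(1 + n))).

Let measurable_uncons_rV : measurable_fun setT uncons_rV.
Proof.
apply/measurable_fun_pair; first exact: (measurable_rV_coord ord0).
apply: measurable_fun_rVP => i.
rewrite (_ : _ \o _ = rV_coord (@rshift 1 n i)); first exact: measurable_rV_coord.
by apply/funext => v; rewrite /rV_coord/= mxE.
Qed.

Let cons_rVK : cancel (@cons_rV R n) uncons_rV.
Proof.
move=> [a v]; congr pair.
  rewrite /cons_rV (_ : ord0 = @lshift 1 n ord0 :> 'I_n.+1); last exact/val_inj.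
  by apply: etrans (row_mxEl _ _ _ _) _; rewrite mxE eqxx.
by rewrite /cons_rV /= row_mxKr.
Qed.

Let lebesgue_rV_step_sigma_finite : sigma_finite setT lebesgue_rV_step.
Proof.
have /sigma_finiteP[F [TF ndF Foo]] := sigma_finiteT (@lebesgue_measure R).
have /sigma_finiteP[G [TG ndG Goo]] := sigma_finiteT mu.
exists (fun k => uncons_rV @^-1` (F k `*` G k)).
  apply/esym; rewrite -subTset => v _.
  have : setT (uncons_rV v).1 by [].
  rewrite TF => -[i _ Fi].
  have : setT (uncons_rV v).2 by [].
  rewrite TG => -[j _ Gj].
  exists (maxn i j) => //; split.
    by move: Fi; exact/subsetPset/ndF/leq_maxl.
  by move: Gj; exact/subsetPset/ndG/leq_maxr.
move=> k; have [mF Fk] := Foo k; have [mG Gk] := Goo k; split.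
  rewrite -[X in measurable X]setTI.
  by apply: measurable_uncons_rV => //; exact: measurableX.
rewrite /lebesgue_rV_step /pushforward -comp_preimage.
have -> : uncons_rV \o @cons_rV R n = id by apply/funext.
by rewrite preimage_id product_measure1E// lte_mul_pinfty// ge0_fin_numE.
Qed.

HB.instance Definition _ := Measure_isSigmaFinite.Build _ _ _ lebesgue_rV_step
  lebesgue_rV_step_sigma_finite.

End lebesgue_rV_step.

(* Lebesgue measure on R^N: the N-fold product of Lebesgue measure on R. *)
Fixpoint lebesgue_rV (R : realType) (N : nat) :
    {sigma_finite_measure set 'rV[R]_N -> \bar R} :=
  match N with
  | 0 => \d_(0 : 'rV[R]_0)
  | n.+1 => lebesgue_rV_step (lebesgue_rV R n)
  end.

Fixpoint Ck (R : realType) (V W : normedModType R) (k : nat) (f : V -> W) :=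
  match k with
  | 0 => continuous f
  | k'.+1 => (forall x, differentiable f x) /\ forall v, Ck k' ('D_v f)
  end.

Definition smooth (R : realType) (V W : normedModType R) (f : V -> W) :=
  forall k, Ck k f.

Record lieGroup (R : realType) (N : nat) := LieGroup {
  lg_mul : 'rV[R]_N -> 'rV[R]_N -> 'rV[R]_N;
  lg_inv : 'rV[R]_N -> 'rV[R]_N;
  lg_one : 'rV[R]_N;
  lg_mulA : associative lg_mul;
  lg_mul1 : left_id lg_one lg_mul;
  lg_mulr1 : right_id lg_one lg_mul;
  lg_mulV : left_inverse lg_one lg_inv lg_mul;
  lg_mulrV : right_inverse lg_one lg_inv lg_mul;
  lg_mul_smooth :
    smooth (fun z : 'rV[R]_N * 'rV[R]_N => lg_mul z.1 z.2);
  lg_inv_smooth : smooth lg_inv }.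

Definition dilation (R : realType) (N : nat) (nu : 'I_N -> R) (t : R)
    (x : 'rV[R]_N) : 'rV[R]_N :=
  \row_i (t `^ (nu i) * x ord0 i).

(* For t > 0 the map D_t is a linear bijection with inverse D_(1/t), so it is an
   automorphism as soon as it is multiplicative. *)
Record homogeneousGroup (R : realType) (N : nat) := HomogeneousGroup {
  hg_lie :> lieGroup R N;
  hg_weight : 'I_N -> R;
  hg_weight_gt0 : forall i, 0 < hg_weight i;
  hg_dilationM : forall t : R, 0 < t ->
    {morph dilation hg_weight t : x y / lg_mul hg_lie x y} }.

Definition hg_dil (R : realType) N (G : homogeneousGroup R N) (t : R) :=
  dilation (hg_weight G) t.

Definition homogeneous_dim (R : realType) N (G : homogeneousGroup R N) : R :=
  \sum_(i < N) hg_weight G i.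

Record quasiNorm (R : realType) N (G : homogeneousGroup R N) := QuasiNorm {
  qnorm :> 'rV[R]_N -> R;
  qnorm_continuous : continuous qnorm;
  qnorm_ge0 : forall x, 0 <= qnorm x;
  qnormV : forall x, qnorm (lg_inv G x) = qnorm x;
  qnormZ : forall t x, 0 < t -> qnorm (hg_dil G t x) = t * qnorm x;
  qnorm_eq0 : forall x, qnorm x = 0 <-> x = lg_one G }.

Definition qball (R : realType) N (G : homogeneousGroup R N)
    (nrm : quasiNorm G) (x : 'rV[R]_N) (r : R) : set 'rV[R]_N :=
  [set y | nrm (lg_mul G (lg_inv G x) y) < r].

Section morrey.
Local Open Scope ereal_scope.
Context {R : realType} {N : nat} {G : homogeneousGroup R N}.
Variable nrm : quasiNorm G.
Implicit Types (f u : 'rV[R]_N -> \bar R) (p lam gamma : R).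

Definition Lp_loc p f :=
  measurable_fun [set: 'rV[R]_N] f /\
  forall K : set 'rV[R]_N, compact K ->
    \int[lebesgue_rV R N]_(y in K) `|f y| `^ p < +oo.

Definition morrey_norm p lam f : \bar R :=
  (ereal_sup [set (r `^ (- lam))%:E *
                  \int[lebesgue_rV R N]_(y in qball nrm x r) `|f y| `^ p
             | x in [set: 'rV[R]_N] & r in [set r : R | (0 < r)%R]]) `^ p^-1.

Definition morrey p lam f := Lp_loc p f /\ morrey_norm p lam f < +oo.

(* Where the integral does not converge absolutely, the value is infinite
   (+oo - +oo = -oo), so a bound on the Morrey norm of the potential includes
   absolute convergence almost everywhere. At y = x the kernel is 0 `^ (gamma - Q) = 0
   rather than infinite; this is a null set. *)
Definition riesz_potential gamma u (x : 'rV[R]_N) : \bar R :=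
  \int[lebesgue_rV R N]_y
    ((nrm (lg_mul G (lg_inv G y) x) `^ (gamma - homogeneous_dim G))%:E * u y).

End morrey.

(* Main.v *)
(** By Young's inequality the Morrey bound on [u] gives
    [\int_B(x,r) |u| <= C W r^(Q - kappa)] with [kappa = (Q - lam)/p > gamma], so the
    part of the potential coming from [d(x,y) >= rho] is at most
    [C W rho^(gamma - kappa)]. No maximal function is needed: for a level [s], split
    [v = |u|] into [min(v, s)] and the excess over [s], and choose [rho] so that the
    far part and the near part of [min(v, s)] are balanced. What remains is the near
    potential of [v 1_(v > s)], controlled in [L^1] by Tonelli. This bounds the measure
    of [{I v > Z s^(p/q)}] by [(1/2s) \int_(v > s) v], and a dyadic layer cake
    decomposition turns that into
    [\int (I v)^q <= C W^(q - p) \int v^p]. Applying it to [u] restricted to a dilated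
    ball, and the far estimate to the rest, gives the Morrey bound.

    Only [mu(B(x,r)) <= A r^Q] is used about the measure. It follows from the
    invariance of Lebesgue measure under left translations: by homogeneity of the
    product and continuity of its derivative at the origin, the [i]-th coordinate of
    [x * y] is [y_i] plus a function of [x] and of the coordinates of [y] of weight
    smaller than that of [i], so that a left translation is a composition of shears. *)

Require Import Defs.
From HB Require Import structures.
From mathcomp Require Import all_boot all_order all_algebra.
From mathcomp Require Import all_classical all_reals all_analysis.
From mathcomp Require Import measurable_realfun.
From mathcomp Require Import ring lra.

Set Implicit Arguments.
Unset Strict Implicit.
Unset Printing Implicit Defensive.

Import Order.TTheory GRing.Theory Num.Theory.
Import numFieldNormedType.Exports.

Local Open Scope classical_set_scope.
Local Open Scope ring_scope.

(** * Level sets and dyadic sums *)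

Section geometric_bounds.
Local Open Scope ereal_scope.
Context {R : realType}.

Lemma nneseries_geometric_le (u : (\bar R)^nat) (B theta : R) :
  (0 < theta < 1)%R -> (forall k, 0 <= u k) ->
  (forall k, u k <= (B * theta ^+ k)%:E) ->
  \sum_(k <oo) u k <= (B / (1 - theta))%:E.
Proof.
move=> /andP[theta0 theta1] u0 uB.
have B0 : (0 <= B)%R.
  by rewrite -lee_fin (le_trans (u0 0%N))// (le_trans (uB 0%N))// mulr1.
apply: lime_le; first exact: is_cvg_nneseries.
apply: nearW => n.
apply: (@le_trans _ _ (\sum_(0 <= k < n) (B * theta ^+ k)%:E)).
  exact: lee_sum.
rewrite sumEFin lee_fin; apply: (geometric_le_lim n) => //.
by rewrite ger0_norm// ltW.
Qed.

(** The sets [S k] may overlap: the indicator of [E] is at most the sum of theirs, and integrating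
    term by term leaves a geometric series. *)
Lemma integral_geometric_cover_le d (T : measurableType d)
    (mu : {measure set T -> \bar R}) (E : set T) (S : (set T)^nat)
    (f : T -> \bar R) (B theta : R) :
  measurable E -> (forall k, measurable (S k)) -> measurable_fun setT f ->
  (forall x, 0 <= f x) -> E `<=` \bigcup_k S k -> (0 < theta < 1)%R ->
  (forall k, \int[mu]_(x in S k) f x <= (B * theta ^+ k)%:E) ->
  \int[mu]_(x in E) f x <= (B / (1 - theta))%:E.
Proof.
move=> mE mS mf f0 ES theta01 fB.
have mfS k : measurable_fun setT (f \_ (S k)).
  by apply/(measurable_restrictT _ (mS k)); exact: measurable_funTS.
have fS0 k x : 0 <= (f \_ (S k)) x by rewrite patchE; case: ifP.
apply: (@le_trans _ _ (\int[mu]_x \sum_(k <oo) (f \_ (S k)) x)).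
  rewrite integral_mkcond; apply: ge0_le_integral => //.
  - by move=> x _; rewrite patchE; case: ifP.
  - by apply/(measurable_restrictT _ mE); exact: measurable_funTS.
  - by apply: ge0_emeasurable_sum.
  - move=> x _; rewrite patchE; case: ifPn => [/set_mem /ES [k _ Skx]|_].
      apply: le_trans (nneseries_lim_ge k.+1 _) => //.
      rewrite big_nat_recr//= patchE mem_set// leeDr//.
      exact: sume_ge0.
    exact: nneseries_ge0.
rewrite integral_nneseries//.
apply: nneseries_geometric_le => // k; last by rewrite -integral_mkcond.
exact: integral_ge0.
Qed.

End geometric_bounds.

(** * Dyadic scales *)

Section dyadic.
Context {R : realType}.

Lemma powR2N_itv (beta : R) : 0 < beta -> 0 < 2 `^ (- beta) < 1.
Proof.
move=> beta0; rewrite powR_gt0//= powRN invf_lt1 ?powR_gt0//.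
by have := @gt0_ltr_powR _ _ beta0 1 2; rewrite powR1; apply; rewrite ?nnegrE ?ltr1n.
Qed.

(** The exponent is the least [n] with [b <= eps * 2 ^+ n.+1]; the lower inequality is its
    minimality, or [eps < b] when [n = 0]. *)
Lemma dyadic_bracket (eps b : R) : 0 < eps -> eps < b ->
  exists k, eps * 2 ^+ k < b <= eps * 2 ^+ k.+1.
Proof.
move=> eps0 epsb.
have [n bn] : exists n, b <= eps * 2 ^+ n.+1.
  exists (Num.truncn (b / eps)); rewrite mulrC -ler_pdivrMr//.
  apply/ltW; apply: lt_le_trans (truncnS_gt _) _.
  by rewrite -natrX ler_nat ltnW// ltn_expl.
case: (ex_minnP (ex_intro (fun n => b <= eps * 2 ^+ n.+1) n bn)) => -[|k] bk kmin.
  by exists 0%N; rewrite expr0 mulr1 epsb.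
exists k.+1; rewrite bk andbT ltNge; apply/negP => /kmin.
by rewrite ltnn.
Qed.

(** The terms grow geometrically, so the largest one controls the sum, uniformly in [eps] and [n].
    This uniformity later allows [eps] to tend to 0. *)
Lemma dyadic_powR_sum_le (eps beta a : R) n : 0 < eps -> 0 < beta -> 0 <= a ->
  \sum_(0 <= k < n) (if eps * 2 ^+ k < a then (eps * 2 ^+ k) `^ beta else 0) <=
  a `^ beta / (1 - 2 `^ (- beta)).
Proof.
move=> eps0 beta0 a0.
set t := fun k => eps * 2 ^+ k; set theta := 2 `^ (- beta).
have t0 k : 0 < t k by rewrite mulr_gt0// exprn_gt0.
have /andP[theta0 theta1] : 0 < theta < 1 by exact: powR2N_itv.
have tS k : t k `^ beta = theta * t k.+1 `^ beta.
  have -> : t k.+1 = 2 * t k by rewrite /t exprS mulrCA.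
  rewrite (powRM _ _ (ltW (t0 k)))// mulrA /theta.
  by rewrite -powRD ?addNr ?powRr0 ?mul1r// pnatr_eq0 implybT.
(* The induction needs the cap [t m]: when [t m.+1 < a], the previous bound is [theta / (1 - theta)]
   times [t m.+1 ^ beta], and adding the new term gives exactly the next bound. *)
suff H m : \sum_(0 <= k < m.+1) (if t k < a then t k `^ beta else 0) <=
    Num.min a (t m) `^ beta / (1 - theta).
  case: n => [|n]; first by rewrite big_nil divr_ge0 ?powR_ge0// subr_ge0 ltW.
  apply: (le_trans (H n)); rewrite ler_pM2r ?invr_gt0 ?subr_gt0//.
  by apply: (ge0_ler_powR (ltW beta0)); rewrite ?nnegrE ?le_min ?ge_min ?lexx ?a0 ?(ltW (t0 _)).
elim: m => [|m IH].
  rewrite big_nat1; case: ifPn => ta.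
    rewrite min_r ?(ltW ta)// ler_pdivlMr ?subr_gt0// ler_piMr ?powR_ge0//.
    by rewrite gerBl ltW.
  by rewrite divr_ge0 ?powR_ge0// subr_ge0 ltW.
have tmS : t m <= t m.+1.
  by rewrite /t ler_pM2l// ler_eXn2l ?ltr1n.
rewrite big_nat_recr//=; case: ifPn => ta.
  rewrite (min_r (ltW ta)); apply: (le_trans (lerD IH (lexx _))).
  rewrite min_r; last exact: ltW (le_lt_trans tmS ta).
  rewrite tS ler_pdivlMr ?subr_gt0// mulrDl divfK ?gt_eqF ?subr_gt0//.
  by rewrite mulrBr mulr1 [theta * _]mulrC addrC subrK.
rewrite addr0 (le_trans IH)// ler_pM2r ?invr_gt0 ?subr_gt0//.
apply: (ge0_ler_powR (ltW beta0)); rewrite ?nnegrE ?le_min ?ge_min ?lexx ?a0 ?(ltW (t0 _))//=.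
by rewrite tmS orbT.
Qed.
End dyadic.

(** * A strong type estimate from level set inequalities *)

Section strong_type.
Local Open Scope ereal_scope.
Context d (T : measurableType d) (R : realType) (mu : {measure set T -> \bar R}).

(** The single level [s] with [s < a <= 2 * s] already suffices; for [a = +oo] this is applied to
    arbitrarily large finite [b]. *)
Lemma dyadic_layers_ge (eps p : R) (a : \bar R) : (0 < eps)%R -> (1 < p)%R ->
  eps%:E < a ->
  a `^ p <= \sum_(k <oo) (if (eps * 2 ^+ k)%:E < a
                          then ((2 * (eps * 2 ^+ k)) `^ p)%:E else 0).
Proof.
move=> eps0 p1 epsa; pose u k := if (eps * 2 ^+ k)%:E < a
            then ((2 * (eps * 2 ^+ k)) `^ p)%:E else 0.
rewrite -[leRHS]/(\sum_(k <oo) u k).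
have u0 k : 0 <= u k by rewrite /u; case: ifP => // _; rewrite lee_fin powR_ge0.
have key (b : R) : (eps < b)%R -> b%:E <= a ->
    (b `^ p)%:E <= \sum_(k <oo) u k.
  move=> epsb ba.
  have [k /andP[kb bk]] := dyadic_bracket eps0 epsb.
  apply: le_trans (nneseries_lim_ge k.+1 _) => //.
  rewrite big_nat_recr//= {2}/u (lt_le_trans _ ba) ?lte_fin//.
  apply: (@le_trans _ _ ((2 * (eps * 2 ^+ k)) `^ p)%:E); last first.
    by rewrite leeDr//; exact: sume_ge0.
  rewrite lee_fin; apply: ge0_ler_powR; rewrite ?nnegrE.
  - lra.
  - lra.
  - by rewrite !mulr_ge0// ?exprn_ge0// ltW.
  - by rewrite mulrCA -exprS.
have p0 : (0 < p)%R by lra.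
have [ay|aNy] := eqVneq a +oo; last first.
  have aE : a = (fine a)%:E by rewrite fineK// fin_real// (lt_trans (ltNyr eps))//= ltey.
  rewrite [leLHS](congr1 (fun z => z `^ p) aE) poweR_EFin.
  by apply: key; [rewrite -lte_fin -aE|rewrite -aE].
rewrite (@eq_infty _ (\sum_(k <oo) u k)) ?leey// => r.
(* [b > eps] makes [key] applicable, and [b >= 1] gives [b ^ p >= b >= r]. *)
pose b := Num.max (1 + eps)%R `|r|%R.
have b1 : (1 + eps <= b)%R by rewrite le_max lexx.
apply: le_trans (key b _ _); last 2 first.
- lra.
- by rewrite ay leey.
rewrite lee_fin (le_trans (ler_norm r))//.
apply: (@le_trans _ _ b); first by rewrite le_max lexx orbT.
by rewrite le1r_powR//; lra.
Qed.

(** Only levels below [a] contribute, and their powers [p - 1] add up to order [a ^ (p - 1)] by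
    [dyadic_powR_sum_le]; the factor [a] completes [a ^ p]. *)
Lemma dyadic_layers_le (eps p c : R) (a : \bar R) : (0 < eps)%R -> (1 < p)%R ->
  (0 < c)%R -> 0 <= a ->
  \sum_(k <oo) ((c * (eps * 2 ^+ k) `^ (p - 1))%:E *
                (if (eps * 2 ^+ k)%:E < a then a else 0)) <=
  (c / (1 - 2 `^ (- (p - 1))))%:E * a `^ p.
Proof.
move=> eps0 p1 c0.
have p0 : (0 < p)%R by lra.
have p10 : (0 < p - 1)%R by lra.
have /andP[th0 th1] := powR2N_itv p10.
case: a => [b| |]// b0; last first.
  by rewrite poweRyr ?gt_eqF// gt0_muley ?leey// lte_fin divr_gt0// subr_gt0.
apply: lime_le.
  apply: is_cvg_nneseries => k _ _; rewrite mule_ge0//; last by case: ifP.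
  by rewrite lee_fin mulr_ge0 ?powR_ge0// ltW.
apply: nearW => n.
rewrite (eq_bigr (fun k => (c * b * (if (eps * 2 ^+ k < b)%R then
    (eps * 2 ^+ k) `^ (p - 1) else 0))%:E)) => [|k _]; last first.
  rewrite lte_fin; case: ifP => _; last by rewrite mule0 mulr0.
  by rewrite -EFinM mulrAC.
rewrite sumEFin -mulr_sumr poweR_EFin -EFinM lee_fin.
rewrite lee_fin in b0.
rewrite -(mulr_powRB1 b0 p0) mulrACA ler_wpM2l ?mulr_ge0 ?(ltW c0)//.
by rewrite [leRHS]mulrC; exact: dyadic_powR_sum_le.
Qed.

(** Dyadic layer cake: [Phi ^ p] is bounded by a sum over levels [s k], the hypothesis is used at
    each level, and sum and integral are exchanged. What remains is the sum of [s k ^ (p - 1)] times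
    [v] over the levels below [v], of order [v ^ p] because [p > 1]. *)
Lemma strong_type_of_level_sets (Phi v : T -> \bar R) (c p : R) :
  (1 < p)%R -> (0 < c)%R ->
  measurable_fun setT Phi -> (forall x, 0 <= Phi x) ->
  measurable_fun setT v -> (forall x, 0 <= v x) ->
  (forall s : R, (0 < s)%R -> mu [set x | s%:E < Phi x] <=
     (c / s)%:E * \int[mu]_(x in [set x | s%:E < v x]) v x) ->
  \int[mu]_x Phi x `^ p <=
  (2 `^ p * c / (1 - 2 `^ (- (p - 1))))%:E * \int[mu]_x v x `^ p.
Proof.
move=> p1 c0 mPhi Phi0 mv v0 weak.
have mlev (g : T -> \bar R) (s : R) : measurable_fun setT g ->
    measurable [set x | s%:E < g x].
  by move=> mg; rewrite -[X in measurable X]setTI; exact: emeasurable_fun_o_infty.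
have mpow (g : T -> \bar R) : measurable_fun setT g ->
    measurable_fun setT (fun x => g x `^ p).
  by move=> mg; apply: (measurableT_comp (measurable_poweR p)).
have p10 : (0 < p - 1)%R by lra.
have /andP[th0 th1] := powR2N_itv p10.
set K := (2 `^ p * c)%R.
have K0 : (0 < K)%R by rewrite mulr_gt0// powR_gt0.
(* Dyadic levels start at a positive [eps], so the set [Phi > eps] comes first, with a constant free
   of [eps]. *)
have trunc (eps : R) : (0 < eps)%R ->
    \int[mu]_(x in [set x | eps%:E < Phi x]) Phi x `^ p <=
    (K / (1 - 2 `^ (- (p - 1))))%:E * \int[mu]_x v x `^ p.
  move=> eps0.
  pose s k : R := (eps * 2 ^+ k)%R.
  have s0 k : (0 < s k)%R by rewrite mulr_gt0// exprn_gt0.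
  pose f k x := if (s k)%:E < Phi x then ((2 * s k) `^ p)%:E else 0.
  pose g k x := (K * s k `^ (p - 1))%:E * (if (s k)%:E < v x then v x else 0).
  have f0 k x : 0 <= f k x by rewrite /f; case: ifP => //; rewrite lee_fin powR_ge0.
  have fE k : f k = cst ((2 * s k) `^ p)%:E \_ [set x | (s k)%:E < Phi x].
    by apply/funext => x; rewrite patchE mem_setE.
  have hE k : (fun x => if (s k)%:E < v x then v x else 0) =
      v \_ [set x | (s k)%:E < v x].
    by apply/funext => x; rewrite patchE mem_setE.
  have mf k : measurable_fun setT (f k).
    rewrite fE; apply/(measurable_restrictT _ (mlev _ _ mPhi)).
    exact: measurable_cst.
  have mh k : measurable_fun setT (fun x => if (s k)%:E < v x then v x else 0).
    rewrite hE; apply/(measurable_restrictT _ (mlev _ _ mv)).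
    exact: measurable_funTS.
  have h0 k x : 0 <= if (s k)%:E < v x then v x else 0 by case: ifP.
  have Ks0 k : (0 <= K * s k `^ (p - 1))%R by rewrite mulr_ge0 ?powR_ge0// ltW.
  have mg k : measurable_fun setT (g k).
    by apply: emeasurable_funM => //; exact: measurable_cst.
  have g0 k x : 0 <= g k x by rewrite mule_ge0// lee_fin.
  apply: (@le_trans _ _ (\int[mu]_x \sum_(k <oo) f k x)).
    apply: (@le_trans _ _
      (\int[mu]_(x in [set x | eps%:E < Phi x]) \sum_(k <oo) f k x)).
      apply: ge0_le_integral => //.
      - exact: mlev.
      - by move=> x _; exact: poweR_ge0.
      - exact/measurable_funTS/mpow.
      - by apply: measurable_funTS; apply: ge0_emeasurable_sum.
      - by move=> x /= epsx; exact: dyadic_layers_ge.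
    apply: ge0_subset_integral => //; first exact: mlev.
    - by apply: ge0_emeasurable_sum.
    - by move=> x _; exact: nneseries_ge0.
  rewrite integral_nneseries//.
  apply: (@le_trans _ _ (\sum_(k <oo) \int[mu]_x g k x)).
    apply: lee_nneseries => [k _ _|k _]; first exact: integral_ge0.
    rewrite fE -integral_mkcond integral_cst; last exact: mlev.
    rewrite ge0_integralZl//; last by rewrite lee_fin.
    rewrite hE -integral_mkcond.
    apply: (@le_trans _ _ (((2 * s k) `^ p)%:E * ((c / s k)%:E *
        \int[mu]_(x in [set x | (s k)%:E < v x]) v x))).
      by rewrite lee_pmul ?lee_fin ?powR_ge0//; exact: weak.
    rewrite muleA -EFinM (powRM _ _ (ltW (s0 k)))//.
    rewrite -(mulr_powRB1 (p:=p) (ltW (s0 k))); last by lra.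
    suff -> : (2 `^ p * (s k * s k `^ (p - 1)) * (c / s k) =
      K * s k `^ (p - 1))%R by [].
    by rewrite /K; field; exact: lt0r_neq0.
  rewrite -integral_nneseries// -ge0_integralZl//; last 3 first.
  - exact: mpow.
  - by move=> x _; exact: poweR_ge0.
  - by rewrite lee_fin divr_ge0 ?ltW// subr_gt0.
  apply: ge0_le_integral => //.
  - by move=> x _; exact: nneseries_ge0.
  - by apply: ge0_emeasurable_sum.
  - by apply: emeasurable_funM; [exact: measurable_cst|exact: mpow].
  - by move=> x _; exact: dyadic_layers_le.
(* These sets increase to [Phi > 0], outside which the integrand vanishes; monotone convergence
   removes the truncation. *)
pose F n := [set x | (n.+1%:R^-1)%:E < Phi x].
have ndF : {homo F : n m / (n <= m)%N >-> (n <= m)%O}.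
  move=> n m nm; apply/subsetPset => x; rewrite /F/=; apply: le_lt_trans.
  by rewrite lee_fin lef_pV2 ?posrE// ler_nat.
have -> : \int[mu]_x Phi x `^ p = \int[mu]_(x in \bigcup_n F n) Phi x `^ p.
  rewrite [RHS]integral_mkcond; apply: eq_integral => x _.
  rewrite patchE; case: ifPn => // /negP xF.
  case: (ltP 0 (Phi x)) => [Phix|Phix0]; last first.
    have -> : Phi x = 0 by apply/eqP; rewrite eq_le Phix0 Phi0.
    by rewrite poweR0r// gt_eqF//; lra.
  case: xF; apply/mem_set.
  have [r r0 rPhi] : exists2 r : R, (0 < r)%R & r%:E <= Phi x.
    case: (Phi x) Phix => [r| |]//; first by rewrite lte_fin => r0; exists r.
    by exists 1%R => //; exact: leey.
  have [n] := ltr_add_invr r0; rewrite add0r => nr.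
  by exists n => //; rewrite /F/= (lt_le_trans _ rPhi)// lte_fin.
have mPhip := mpow _ mPhi.
have cvF : \int[mu]_(x in F n) Phi x `^ p @[n --> \oo] -->
    \int[mu]_(x in \bigcup_n F n) Phi x `^ p.
  apply: ge0_nondecreasing_set_cvg_integral => //.
  - by move=> n; exact: mlev.
  - by move=> n; exact: measurable_funTS.
  - by move=> n x _; exact: poweR_ge0.
rewrite -(cvg_lim _ cvF)//; apply: lime_le; first by apply/cvg_ex; eexists; exact: cvF.
by apply: nearW => n; exact: trunc.
Qed.
End strong_type.

(** * Potentials on upper regular quasi-metric spaces *)

Lemma measurable_set_bool d (T : measurableType d) (f : T -> bool) :
  measurable_fun setT f -> measurable [set x | f x].
Proof. by move=> mf; rewrite -[X in measurable X]setTI; exact: (mf _ [set true]). Qed.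

Lemma gt0_powRD (R : realType) (x r s : R) : 0 < x ->
  x `^ (r + s) = x `^ r * x `^ s.
Proof. by move=> x0; rewrite powRD//; apply/implyP => _; exact: lt0r_neq0. Qed.

(** * Power kernels on dyadic shells *)

Section shells.
Local Open Scope ereal_scope.
Context d (T : measurableType d) (R : realType) (mu : {measure set T -> \bar R}).
Variables (D : T -> R) (v : T -> \bar R) (W eta e : R).
Hypotheses (mD : measurable_fun setT D) (D0 : forall x, (0 <= D x)%R).
Hypotheses (mv : measurable_fun setT v) (v0 : forall x, 0 <= v x).
Hypothesis e0 : (e < 0)%R.
Hypothesis growth : forall r : R, (0 < r)%R ->
  \int[mu]_(x in [set x | (D x < r)%R]) v x <= (W * r `^ eta)%:E.

Let mlt (r : R) : measurable [set x | (D x < r)%R].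
Proof. exact/measurable_set_bool/measurable_fun_ltr. Qed.

Let mshell (a b : R) : measurable [set x | (a <= D x < b)%R].
Proof.
apply: measurable_set_bool; apply: measurable_and.
  exact: measurable_fun_ler.
exact: measurable_fun_ltr.
Qed.

Let ge0_ker x : 0 <= ((D x) `^ e)%:E * v x.
Proof. by rewrite mule_ge0// lee_fin powR_ge0. Qed.

Let measurable_ker : measurable_fun setT (fun x => ((D x) `^ e)%:E * v x).
Proof.
apply: emeasurable_funM => //; apply/measurable_EFinP.
by apply: (measurableT_comp (measurable_powR e)).
Qed.

(** Since [e < 0], the kernel is bounded by its value at the inner radius, while [growth] is used at
    the outer one. *)
Lemma shell_integral_le (S : set T) (a b : R) : measurable S ->
  (0 < a)%R -> (0 < b)%R -> (forall x, S x -> (a <= D x < b)%R) ->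
  \int[mu]_(x in S) (((D x) `^ e)%:E * v x) <= (a `^ e * (W * b `^ eta))%:E.
Proof.
move=> mS a0 b0 Sab.
apply: (@le_trans _ _ (\int[mu]_(x in S) ((a `^ e)%:E * v x))).
  apply: ge0_le_integral => //.
  - exact: measurable_funTS.
  - by apply: measurable_funTS; apply: emeasurable_funM => //; exact: measurable_cst.
  - move=> x /Sab /andP[aD _]; rewrite lee_wpmul2r// lee_fin.
    rewrite -[e]opprK [leLHS]powRN [leRHS]powRN lef_pV2 ?posrE ?powR_gt0//; last first.
      exact: lt_le_trans aD.
    by apply: ge0_ler_powR; rewrite ?nnegrE// ?oppr_ge0 ltW.
rewrite ge0_integralZl ?lee_fin ?powR_ge0//; last exact: measurable_funTS.
rewrite EFinM lee_wpmul2l ?lee_fin ?powR_ge0//.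
apply: le_trans (growth b0); apply: ge0_subset_integral => //.
  exact: measurable_funTS.
by move=> x /Sab /andP[].
Qed.

Let powR2X (x : R) k : ((2 ^+ k) `^ x = (2 `^ x) ^+ k)%R.
Proof. by rewrite -!powR_mulrn ?powR_ge0// powRAC. Qed.

(** The shell between [rho / 2 ^ (k + 1)] and [rho / 2 ^ k] contributes at most
    [W rho ^ (eta + e) 2 ^ (- e)] times the [k]-th power of [2 ^ (- (eta + e))], a ratio below 1. *)
Lemma near_shells_le (rho : R) : (0 < rho)%R -> (0 < eta + e)%R ->
  \int[mu]_(x in [set x | (D x < rho)%R]) (((D x) `^ e)%:E * v x) <=
  (W * rho `^ (eta + e) * (2 `^ (- e) / (1 - 2 `^ (- (eta + e)))))%:E.
Proof.
move=> rho0 ee0.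
(* The kernel vanishes where [D x = 0], because [0 `^ e = 0]. *)
have -> : \int[mu]_(x in [set x | (D x < rho)%R]) (((D x) `^ e)%:E * v x) =
    \int[mu]_(x in [set x | (0 < D x < rho)%R]) (((D x) `^ e)%:E * v x).
  rewrite integral_mkcond [RHS]integral_mkcond; apply: eq_integral => x _.
  rewrite !patchE !mem_setE !unfold_in /=; case: (ltP 0%R (D x)) => //= Dx0.
  have -> : D x = 0%R by apply/eqP; rewrite eq_le Dx0 D0.
  by rewrite powR0 ?lt_eqF// mul0e; case: ifP.
rewrite mulrA.
apply: (@integral_geometric_cover_le _ _ _ _ _
  (fun k => [set x | (rho / 2 ^+ k.+1 <= D x < rho / 2 ^+ k)%R])).
- apply: measurable_set_bool; apply: measurable_and; exact: measurable_fun_ltr.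
- by move=> k; exact: mshell.
- by [].
- exact: ge0_ker.
- move=> x /= /andP[Dx0 Dx].
  (* The shell of [x] is found by bracketing [rho] between dyadic multiples of [D x]. *)
  have [k /andP[k1 k2]] := dyadic_bracket Dx0 Dx.
  exists k => //=; rewrite ler_pdivrMr ?exprn_gt0// k2/=.
  by rewrite ltr_pdivlMr ?exprn_gt0.
- exact: powR2N_itv.
move=> k; apply: le_trans (@shell_integral_le _ (rho / 2 ^+ k.+1) (rho / 2 ^+ k) _ _ _ _) _.
- exact: mshell.
- by rewrite divr_gt0// exprn_gt0.
- by rewrite divr_gt0// exprn_gt0.
- by [].
rewrite lee_fin le_eqVlt; apply/orP; left; apply/eqP.
rewrite !(powRM _ (ltW rho0)) ?invr_ge0 ?exprn_ge0//.
rewrite -!powR_inv1 ?exprn_ge0// -!powRrM !powR2X !mulN1r opprD.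
rewrite !gt0_powRD// exprMn exprS; ring.
Qed.

(** The shells now grow outwards, and their contributions decay with ratio [2 ^ (eta + e) < 1]. *)
Lemma far_shells_le (rho : R) : (0 < rho)%R -> (eta + e < 0)%R ->
  \int[mu]_(x in [set x | (rho <= D x)%R]) (((D x) `^ e)%:E * v x) <=
  (W * rho `^ (eta + e) * (2 `^ (eta - e) / (1 - 2 `^ (eta + e))))%:E.
Proof.
move=> rho0 ee0; rewrite mulrA -(opprK (eta + e)%R).
(* [dyadic_bracket] is strict on the left and closed on the right, whereas [D x = rho] can occur and
   the shells are open on the right. Starting at [rho / 2] and doubling the outer radius absorbs
   both. *)
apply: (@integral_geometric_cover_le _ _ _ _ _
  (fun k => [set x | (rho * 2 ^+ k / 2 <= D x < rho * 2 ^+ k * 2)%R])).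
- exact/measurable_set_bool/measurable_fun_ler.
- by move=> k; exact: mshell.
- by [].
- exact: ge0_ker.
- move=> x /= Dx.
  have rho20 : (0 < rho / 2)%R by lra.
  have rho2D : (rho / 2 < D x)%R by lra.
  have [k /andP[k1 k2]] := dyadic_bracket rho20 rho2D.
  exists k => //=; rewrite mulrAC ltW//=.
  have -> : (rho * 2 ^+ k * 2 = 2 * (rho / 2 * 2 ^+ k.+1))%R by rewrite exprS; field.
  by apply: (le_lt_trans k2); rewrite ltr_pMl ?ltr1n// mulr_gt0// exprn_gt0.
- by rewrite powR2N_itv// oppr_gt0.

move=> k; have r0 : (0 < rho * 2 ^+ k)%R by rewrite mulr_gt0// exprn_gt0.
apply: le_trans (@shell_integral_le _ (rho * 2 ^+ k / 2)
  (rho * 2 ^+ k * 2) _ _ _ _) _.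
- exact: mshell.
- by rewrite divr_gt0// mulr_gt0// exprn_gt0.
- by rewrite !mulr_gt0// exprn_gt0.
- by [].
rewrite lee_fin le_eqVlt; apply/orP; left; apply/eqP.
rewrite !opprK !(powRM _ (ltW r0)) ?invr_ge0// !(powRM _ (ltW rho0)) ?exprn_ge0//.
rewrite -!powR_inv1// -!powRrM !powR2X !mulN1r.
rewrite !gt0_powRD// exprMn; ring.
Qed.

End shells.

(** * Level sets of the potential *)

Section potential.
Local Open Scope ereal_scope.
Context d (T : measurableType d) (R : realType).
Variable mu : {sigma_finite_measure set T -> \bar R}.
Variables (dist : T -> T -> R) (A Q gamma : R).
Hypothesis mdist : measurable_fun setT (fun z : T * T => dist z.1 z.2).
Hypothesis dist_ge0 : forall x y, (0 <= dist x y)%R.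
Hypothesis distC : forall x y, dist x y = dist y x.
Hypothesis ball_le : forall x (r : R), (0 < r)%R ->
  mu [set y | (dist x y < r)%R] <= (A * r `^ Q)%:E.
Hypotheses (A0 : (0 < A)%R) (gamma0 : (0 < gamma)%R) (gammaQ : (gamma < Q)%R).

Definition potential (v : T -> \bar R) x : \bar R :=
  \int[mu]_y ((dist x y `^ (gamma - Q))%:E * v y).

(** The constant of [near_shells_le] for the kernel exponent [gamma - Q] and the volume growth
    [A r ^ Q]. *)
Definition near_cst := (A * (2 `^ (Q - gamma) / (1 - 2 `^ (- gamma))))%R.

(** The constant of [far_shells_le] for the same kernel and the growth exponent [Q - kappa]. *)
Definition far_cst (kappa : R) :=
  (2 `^ (2 * Q - gamma - kappa) / (1 - 2 `^ (gamma - kappa)))%R.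

Lemma near_cst_gt0 : (0 < near_cst)%R.
Proof.
have /andP[_ h] := powR2N_itv gamma0.
by rewrite !mulr_gt0 ?powR_gt0// invr_gt0 subr_gt0.
Qed.

Lemma far_cst_gt0 kappa : (gamma < kappa)%R -> (0 < far_cst kappa)%R.
Proof.
move=> gk; have /andP[_] := @powR2N_itv _ (kappa - gamma) ltac:(lra).
by rewrite opprB => h; rewrite divr_gt0 ?powR_gt0// subr_gt0.
Qed.

Let e0 : (gamma - Q < 0)%R. Proof. by rewrite subr_lt0. Qed.

Let measurable_dist x : measurable_fun setT (dist x).
Proof. exact: (measurableT_comp mdist (pair1_measurable x)). Qed.

Let measurable_kernel2 : measurable_fun setT
  (fun z : T * T => (dist z.1 z.2 `^ (gamma - Q))%:E).
Proof.
by apply/measurable_EFinP; apply: (measurableT_comp (measurable_powR _)).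
Qed.

Let measurable_kernel x : measurable_fun setT
  (fun y => (dist x y `^ (gamma - Q))%:E).
Proof. exact: (measurableT_comp measurable_kernel2 (pair1_measurable x)). Qed.

Lemma measurable_ball x r : measurable [set y | (dist x y < r)%R].
Proof. exact/measurable_set_bool/measurable_fun_ltr. Qed.

Lemma measurable_potential v : measurable_fun setT v -> (forall y, 0 <= v y) ->
  measurable_fun setT (potential v).
Proof.
move=> mv v0.
apply: (@measurable_fun_fubini_tonelli_F _ _ _ _ _ mu
  (fun z => (dist z.1 z.2 `^ (gamma - Q))%:E * v z.2)).
  apply: emeasurable_funM => //.
  exact: (measurableT_comp mv measurable_snd).
by move=> z; rewrite mule_ge0// lee_fin powR_ge0.
Qed.

Lemma near_kernel_le x (rho : R) : (0 < rho)%R ->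
  \int[mu]_(y in [set y | (dist x y < rho)%R]) (dist x y `^ (gamma - Q))%:E <=
  (near_cst * rho `^ gamma)%:E.
Proof.
move=> rho0.
have := @near_shells_le _ _ _ mu (dist x) (cst 1) A Q (gamma - Q)
  (measurable_dist x) (dist_ge0 x) (@measurable_cst _ _ _ _ _ _)
  (fun=> lee01) e0.
have -> : (Q + (gamma - Q) = gamma)%R by ring.
move=> /(_ _ rho rho0 gamma0).
rewrite opprB -mulrA [(rho `^ _ * _)%R]mulrC mulrA -/near_cst.
under eq_integral do rewrite mule1.
apply=> r r0; rewrite integral_cst; last exact: measurable_ball.
by rewrite mul1e; exact: ball_le.
Qed.

Lemma far_kernel_le x (v : T -> \bar R) (W kappa rho : R) :
  measurable_fun setT v -> (forall y, 0 <= v y) ->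
  (gamma < kappa)%R -> (0 < rho)%R ->
  (forall r : R, (0 < r)%R ->
   \int[mu]_(y in [set y | (dist x y < r)%R]) v y <= (W * r `^ (Q - kappa))%:E) ->
  \int[mu]_(y in [set y | (rho <= dist x y)%R])
    ((dist x y `^ (gamma - Q))%:E * v y) <=
  (far_cst kappa * W * rho `^ (gamma - kappa))%:E.
Proof.
move=> mv v0 gk rho0 growth.
have := @far_shells_le _ _ _ mu (dist x) v W (Q - kappa) (gamma - Q)
  (measurable_dist x) (dist_ge0 x) mv v0 e0 growth rho rho0.
have -> : (Q - kappa + (gamma - Q) = gamma - kappa)%R by ring.
have -> : (Q - kappa - (gamma - Q) = 2 * Q - gamma - kappa)%R by ring.
rewrite subr_lt0 => /(_ gk).
by rewrite -/(far_cst kappa) mulrC mulrA.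
Qed.

Let near_potential (rho : R) (g : T -> \bar R) x :=
  \int[mu]_(y in [set y | (dist x y < rho)%R])
    ((dist x y `^ (gamma - Q))%:E * g y).

(** Written on [T * T] so that Tonelli's theorem applies. *)
Let near_integrand (rho : R) (g : T -> \bar R) (z : T * T) : \bar R :=
  if (dist z.1 z.2 < rho)%R then (dist z.1 z.2 `^ (gamma - Q))%:E * g z.2 else 0.

Let near_integrand_ge0 rho g z : (forall y, 0 <= g y) ->
  0 <= near_integrand rho g z.
Proof.
move=> g0; rewrite /near_integrand; case: ifP => // _.
by rewrite mule_ge0// lee_fin powR_ge0.
Qed.

Let near_potentialE rho g x :
  near_potential rho g x = \int[mu]_y near_integrand rho g (x, y).
Proof.
rewrite /near_potential integral_mkcond; apply: eq_integral => y _.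
by rewrite patchE mem_setE.
Qed.

Let measurable_near_integrand rho g : measurable_fun setT g ->
  measurable_fun setT (near_integrand rho g).
Proof.
move=> mg; apply: measurable_fun_ifT => //.
- exact: measurable_fun_ltr.
- apply: emeasurable_funM => //.
  exact: (measurableT_comp mg measurable_snd).
Qed.

Let measurable_near_potential rho g : measurable_fun setT g ->
  (forall y, 0 <= g y) -> measurable_fun setT (near_potential rho g).
Proof.
move=> mg g0; rewrite (_ : near_potential rho g =
  fubini_F mu (near_integrand rho g)); last exact/funext/near_potentialE.
apply: measurable_fun_fubini_tonelli_F; first exact: measurable_near_integrand.
by move=> z; exact: near_integrand_ge0.
Qed.

(** By Tonelli the kernel is integrated in its first variable for fixed [y]; symmetry of [dist]
    makes this an integral over a ball centred at [y], bounded by [near_kernel_le]. *)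
Let integral_near_potential_le (rho : R) (g : T -> \bar R) : (0 < rho)%R ->
  measurable_fun setT g -> (forall y, 0 <= g y) ->
  \int[mu]_x near_potential rho g x <=
  (near_cst * rho `^ gamma)%:E * \int[mu]_y g y.
Proof.
move=> rho0 mg g0.
under eq_integral do rewrite near_potentialE.
rewrite (fubini_tonelli _ (measurable_near_integrand _ mg)); last first.
  by move=> z; exact: near_integrand_ge0.
rewrite -ge0_integralZl//; last first.
  by rewrite lee_fin mulr_ge0 ?powR_ge0// ltW// near_cst_gt0.
have mh := measurable_near_integrand rho mg.
apply: ge0_le_integral => //.
- by move=> y _; apply: integral_ge0 => x _; exact: near_integrand_ge0.
- apply: (measurable_fun_fubini_tonelli_G _ mh).
  by move=> z; exact: near_integrand_ge0.
- by apply: emeasurable_funM => //; exact: measurable_cst.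
move=> y _.
have -> : \int[mu]_x near_integrand rho g (x, y) =
    g y * \int[mu]_(x in [set x | (dist y x < rho)%R])
            (dist y x `^ (gamma - Q))%:E.
  rewrite [in RHS]integral_mkcond -ge0_integralZl//.
  - apply: eq_integral => x _; rewrite patchE /near_integrand/= distC.
    case: ifPn => h; first by rewrite mem_set// muleC.
    by rewrite memNset ?mule0//; exact/negP.
  - apply/(measurable_restrictT _ (measurable_ball y rho)).
    exact: measurable_funTS.
  - by move=> x _; rewrite patchE; case: ifP => // _; rewrite lee_fin powR_ge0.
by rewrite muleC lee_wpmul2r//; exact: near_kernel_le.
Qed.

(** Let [tau = a rho ^ gamma s]. The far part of [v] and the near part of what lies below [s]
    contribute at most [tau] each. Hence where the potential exceeds [4 tau], the near potential of
    [v 1_(v > s)] exceeds [2 tau], and Chebyshev's inequality with its [L^1] bound gives the factor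
    [a rho ^ gamma / (2 tau) = 1 / (2 s)]. *)
Lemma potential_level_le (v : T -> \bar R) (W kappa s : R) :
  measurable_fun setT v -> (forall y, 0 <= v y) ->
  (gamma < kappa)%R -> (0 < W)%R -> (0 < s)%R ->
  (forall x (r : R), (0 < r)%R ->
   \int[mu]_(y in [set y | (dist x y < r)%R]) v y <= (W * r `^ (Q - kappa))%:E) ->
  mu [set x | (4 * near_cst `^ (1 - gamma / kappa) *
     (far_cst kappa * W) `^ (gamma / kappa) * s `^ (1 - gamma / kappa))%:E <
     potential v x] <=
  (2^-1 / s)%:E * \int[mu]_(x in [set x | s%:E < v x]) v x.
Proof.
move=> mv v0 gk W0 s0 growth.
have kappa0 : (0 < kappa)%R := lt_trans gamma0 gk.
set a := near_cst; set b := (far_cst kappa * W)%R; set th := (gamma / kappa)%R.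
have a0 : (0 < a)%R by exact: near_cst_gt0.
have b0 : (0 < b)%R by rewrite mulr_gt0// far_cst_gt0.
(* [rho] balances the far part of [v] and the near part of [min(v, s)]. *)
pose rho := ((b / (a * s)) `^ kappa^-1)%R.
have as0 : (0 < a * s)%R by rewrite mulr_gt0.
have q0 : (0 < b / (a * s))%R by rewrite divr_gt0.
have rho0 : (0 < rho)%R by rewrite powR_gt0.
have rhog0 : (0 < rho `^ gamma)%R by rewrite powR_gt0.
have far_eq : (b * rho `^ (gamma - kappa) = a * rho `^ gamma * s)%R.
  rewrite gt0_powRD// powRN -[in (rho `^ kappa)%R]powRrM mulVf ?gt_eqF//.
  rewrite powRr1 ?(ltW q0)//; by field; rewrite !gt_eqF.
(* The level in the statement is what [4 tau] becomes after substituting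
   [rho ^ gamma = (b / (a s)) ^ th]. *)
have -> : (4 * a `^ (1 - th) * b `^ th * s `^ (1 - th) =
    4 * (a * rho `^ gamma * s))%R.
  rewrite /rho -powRrM [(kappa^-1 * _)%R]mulrC -/th.
  rewrite powRM ?invr_ge0 ?(ltW b0) ?(ltW as0)//.
  rewrite -powR_inv1 ?(ltW as0)// -powRrM mulN1r.
  rewrite (powRM _ (ltW a0) (ltW s0)) !gt0_powRD// !powRr1 ?(ltW a0) ?(ltW s0)//.
  ring.
set tau := (a * rho `^ gamma * s)%R.
have tau0 : (0 < tau)%R by exact: mulr_gt0 (mulr_gt0 a0 rhog0) s0.
(* [g] keeps the whole of [v] where [v > s], so it dominates the excess over [s] and
   [v <= g + s]. *)
pose g y := if s%:E < v y then v y else 0.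
have g0 y : 0 <= g y by rewrite /g; case: ifP.
have mlev : measurable [set y | s%:E < v y].
  by rewrite -[X in measurable X]setTI; exact: emeasurable_fun_o_infty.
have gE : g = v \_ [set y | s%:E < v y].
  by apply/funext => y; rewrite patchE mem_setE.
have mg : measurable_fun setT g.
  by rewrite gE; apply/(measurable_restrictT _ mlev)/measurable_funTS.
have ker0 x y : 0 <= (dist x y `^ (gamma - Q))%:E by rewrite lee_fin powR_ge0.
have split x : potential v x <= near_potential rho g x + (tau + tau)%:E.
  have mkv w : measurable_fun setT w ->
      measurable_fun setT (fun y => (dist x y `^ (gamma - Q))%:E * w y).
    by move=> mw; exact: emeasurable_funM.
  have mB := measurable_ball x rho.
  have mC : measurable [set y | (rho <= dist x y)%R].
    exact/measurable_set_bool/measurable_fun_ler.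
  have -> : potential v x = near_potential rho v x +
      \int[mu]_(y in [set y | (rho <= dist x y)%R])
        ((dist x y `^ (gamma - Q))%:E * v y).
    rewrite /potential /near_potential -ge0_integral_setU//.
    - congr (integral _ _ _); apply/seteqP; split => y //= _.
      by case: (ltP (dist x y) rho); [left|right].
    - by apply: measurable_funTS; exact: mkv.
    - by move=> y _; rewrite mule_ge0.
    - apply/disj_setPS => y [/= y1 y2].
      by have := lt_le_trans y1 y2; rewrite ltxx.
  rewrite [(tau + tau)%:E]EFinD [leRHS]addeA; apply: leeD; last first.
    by rewrite /tau -far_eq; exact: (far_kernel_le mv v0 gk rho0 (growth x)).
  apply: (@le_trans _ _ (\int[mu]_(y in [set y | (dist x y < rho)%R])
     ((dist x y `^ (gamma - Q))%:E * g y + s%:E * (dist x y `^ (gamma - Q))%:E))).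
    apply: ge0_le_integral => //.
    - by move=> y _; rewrite mule_ge0.
    - by apply: measurable_funTS; exact: mkv.
    - apply: emeasurable_funD; apply: measurable_funTS; first exact: mkv.
      by apply: emeasurable_funM => //; exact: measurable_cst.
    - move=> y _; rewrite [s%:E * _]muleC -ge0_muleDr//; last first.
        by rewrite lee_fin ltW.
      rewrite lee_wpmul2l// /g; case: (ltP s%:E (v y)) => svy.
        by rewrite leeDl// lee_fin ltW.
      by rewrite add0e.
  rewrite ge0_integralD//; last 4 first.
  - by move=> y _; rewrite mule_ge0.
  - by apply: measurable_funTS; exact: mkv.
  - by move=> y _; rewrite mule_ge0// lee_fin ltW.
  - by apply: measurable_funTS; apply: emeasurable_funM => //; exact: measurable_cst.
  apply: leeD => //.
  rewrite ge0_integralZl//; last 2 first.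
  - exact: measurable_funTS.
  - by rewrite lee_fin ltW.
  rewrite /tau mulrC EFinM lee_wpmul2l ?lee_fin ?(ltW s0)//.
  exact: near_kernel_le.
have mN : measurable_fun setT (near_potential rho g).
  exact: measurable_near_potential.
have N0 x : 0 <= near_potential rho g x.
  by apply: integral_ge0 => y _; rewrite mule_ge0.
have mL : measurable [set x | (2 * tau)%:E < near_potential rho g x].
  by rewrite -[X in measurable X]setTI; exact: emeasurable_fun_o_infty.
apply: (@le_trans _ _ (mu [set x | (2 * tau)%:E < near_potential rho g x])).
  apply: le_measure; rewrite ?inE//.
    rewrite -[X in measurable X]setTI; apply: emeasurable_fun_o_infty => //.
    exact: measurable_potential.
  move=> x /= h; have {h} := lt_le_trans h (split x).
  rewrite -lteBlDr// -EFinB.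
  by have -> : (4 * tau - (tau + tau) = 2 * tau)%R by ring.
have t20 : (0 < 2 * tau)%R by rewrite mulr_gt0.
have : (2 * tau)%:E * mu [set x | (2 * tau)%:E < near_potential rho g x] <=
    (a * rho `^ gamma)%:E * \int[mu]_y g y.
  apply: le_trans (integral_near_potential_le rho0 mg g0).
  rewrite -integral_cst//.
  apply: (@le_trans _ _ (\int[mu]_(x in [set x | (2 * tau)%:E <
      near_potential rho g x]) near_potential rho g x)).
    apply: ge0_le_integral => //.
    - by move=> x _; rewrite lee_fin ltW.
    - exact: measurable_funTS.
    - by move=> x /= /ltW.
  exact: ge0_subset_integral.
have -> : \int[mu]_y g y = \int[mu]_(x in [set x | s%:E < v x]) v x.
  by rewrite gE -integral_mkcond.
rewrite muleC -lee_pdivlMr//; move=> /le_trans; apply.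
rewrite muleC muleA -EFinM.
suff -> : ((2 * tau)^-1 * (a * rho `^ gamma) = 2^-1 / s)%R by [].
by rewrite /tau; field; rewrite !gt_eqF.
Qed.

End potential.

Lemma ge0_le_poweR (R : realType) (r : R) (x y : \bar R) : 0 <= r ->
  (0 <= x -> x <= y -> x `^ r <= y `^ r)%E.
Proof.
move=> r0 x0 xy; apply: gt0_ler_poweR => //; rewrite in_itv/= leey andbT//.
exact: le_trans xy.
Qed.

(** * From level sets to an [L^q] bound *)

Section morrey_potential.
Local Open Scope ereal_scope.
Context d (T : measurableType d) (R : realType).
Variable mu : {sigma_finite_measure set T -> \bar R}.
Variables (dist : T -> T -> R) (A Q gamma : R).
Hypothesis mdist : measurable_fun setT (fun z : T * T => dist z.1 z.2).
Hypothesis dist_ge0 : forall x y, (0 <= dist x y)%R.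
Hypothesis distC : forall x y, dist x y = dist y x.
Hypothesis ball_le : forall x (r : R), (0 < r)%R ->
  mu [set y | (dist x y < r)%R] <= (A * r `^ Q)%:E.
Hypotheses (A0 : (0 < A)%R) (gamma0 : (0 < gamma)%R) (gammaQ : (gamma < Q)%R).

Let mball := measurable_ball mdist.

(** With [Z] the normalization in [integral_potential_powR_le], this is [Z ^ q] without its factor
    [W ^ (q - p)], times the constant of [strong_type_of_level_sets] at [c = 1/2]. *)
Definition potential_cst (p q kappa : R) :=
  (4 `^ q * near_cst A Q gamma `^ p * far_cst Q gamma kappa `^ (q - p) *
   (2 `^ p / 2 / (1 - 2 `^ (- (p - 1)))))%R.

Lemma potential_cst_ge0 p q kappa : (1 < p)%R -> (0 <= potential_cst p q kappa)%R.
Proof.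
move=> p1; have /andP[_ h] := @powR2N_itv _ (p - 1) ltac:(lra).
by rewrite !mulr_ge0 ?powR_ge0 ?invr_ge0// subr_ge0 ltW.
Qed.

(** The substitution [Phi = (pot / Z) ^ (q / p)] turns the set [pot > Z s ^ (p / q)] into [Phi > s].
    Then [potential_level_le] is the hypothesis of [strong_type_of_level_sets], and
    [pot ^ q = Z ^ q Phi ^ p]. *)
Lemma integral_potential_powR_le (v : T -> \bar R) (p q kappa W : R) :
  (1 < p)%R -> (p < q)%R -> (gamma < kappa)%R -> (1 - gamma / kappa = p / q)%R ->
  measurable_fun setT v -> (forall y, 0 <= v y) -> (0 < W)%R ->
  (forall x (r : R), (0 < r)%R ->
   \int[mu]_(y in [set y | (dist x y < r)%R]) v y <= (W * r `^ (Q - kappa))%:E) ->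
  \int[mu]_x potential mu dist Q gamma v x `^ q <=
  (potential_cst p q kappa * W `^ (q - p))%:E * \int[mu]_x v x `^ p.
Proof.
move=> p1 pq gk thE mv v0 W0 growth.
have p0 : (0 < p)%R by lra.
have q0 : (0 < q)%R by lra.
set pot := potential mu dist Q gamma v.
have pot0 x : 0 <= pot x.
  by apply: integral_ge0 => y _; rewrite mule_ge0// lee_fin powR_ge0.
have mpot : measurable_fun setT pot by exact: measurable_potential.
have a0 : (0 < near_cst A Q gamma)%R by exact: near_cst_gt0.
have b0 : (0 < far_cst Q gamma kappa)%R by exact: far_cst_gt0.
(* [Z s ^ (p / q)] is the level in [potential_level_le], rewritten with
   [1 - gamma / kappa = p / q]. *)
pose Z := (4 * near_cst A Q gamma `^ (p / q) *
  (far_cst Q gamma kappa * W) `^ (1 - p / q))%R.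
have bW0 := mulr_gt0 b0 W0.
have Z0 : (0 < Z)%R by exact: mulr_gt0 (mulr_gt0 _ (powR_gt0 _ a0)) (powR_gt0 _ bW0).
pose Phi x := ((Z^-1)%:E * pot x) `^ (q / p).
have Zpot0 x : 0 <= (Z^-1)%:E * pot x by rewrite mule_ge0// lee_fin invr_ge0 ltW.
have mZpot : measurable_fun setT (fun x => (Z^-1)%:E * pot x).
  by apply: emeasurable_funM => //; exact: measurable_cst.
have mPhi : measurable_fun setT Phi.
  exact: (measurableT_comp (measurable_poweR _) mZpot).
have potE x : pot x `^ q = (Z `^ q)%:E * Phi x `^ p.
  rewrite /Phi -poweRrM divfK ?gt_eqF// poweRM ?lee_fin ?invr_ge0 ?(ltW Z0)//.
  rewrite muleA poweR_EFin -EFinM -powRM ?invr_ge0 ?(ltW Z0)//.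
  by rewrite divff ?gt_eqF// powR1 mul1e.
have weak (s : R) : (0 < s)%R -> mu [set x | s%:E < Phi x] <=
    (2^-1 / s)%:E * \int[mu]_(x in [set x | s%:E < v x]) v x.
  move=> s0.
  apply: le_trans (potential_level_le mdist dist_ge0 distC ball_le A0 gamma0 gammaQ
    mv v0 gk W0 s0 growth).
  have mlev (g : T -> \bar R) (t : R) : measurable_fun setT g ->
      measurable [set x | t%:E < g x].
    by move=> mg; rewrite -[X in measurable X]setTI; exact: emeasurable_fun_o_infty.
  apply: le_measure; rewrite ?inE; [exact: mlev|exact: mlev|].
  move=> x /=; rewrite thE (_ : gamma / kappa = 1 - p / q)%R; last by lra.
  rewrite -/Z -/(pot x) !ltNge; apply: contra => potx.
  have -> : s%:E = (s%:E `^ (p / q)) `^ (q / p).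
    rewrite -poweRrM (_ : p / q * (q / p) = 1)%R ?poweRe1 ?lee_fin ?(ltW s0)//.
    by field; rewrite !gt_eqF.
  apply: ge0_le_poweR => //; first by rewrite divr_ge0 ?ltW.
  apply: (@le_trans _ _ ((Z^-1)%:E * (Z * s `^ (p / q))%:E)).
    by rewrite lee_wpmul2l// lee_fin invr_ge0 ltW.
  by rewrite -EFinM mulrA mulVf ?gt_eqF// mul1r poweR_EFin.
under eq_integral do rewrite potE.
rewrite ge0_integralZl//; last 3 first.
- exact: (measurableT_comp (measurable_poweR _) mPhi).
- by move=> x _; exact: poweR_ge0.
- by rewrite lee_fin powR_ge0.
apply: (@le_trans _ _ ((Z `^ q)%:E *
    ((2 `^ p * 2^-1 / (1 - 2 `^ (- (p - 1))))%:E * \int[mu]_x v x `^ p))).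
  rewrite lee_wpmul2l ?lee_fin ?powR_ge0//.
  by apply: strong_type_of_level_sets => // x; exact: poweR_ge0.
rewrite muleA -EFinM lee_wpmul2r//.
  by apply: integral_ge0 => x _; exact: poweR_ge0.
rewrite lee_fin le_eqVlt; apply/orP; left; apply/eqP.
rewrite /Z (powRM _ _ (powR_ge0 _ _)) ?mulr_ge0 ?powR_ge0//.
rewrite (powRM _ _ (powR_ge0 _ _))// -!powRrM divfK ?gt_eqF//.
rewrite (_ : (1 - p / q) * q = q - p)%R; last by field; rewrite gt_eqF.
rewrite (powRM _ (ltW b0) (ltW W0)) /potential_cst; ring.
Qed.

End morrey_potential.

(** * Localization to balls *)

Section morrey_bound.
Local Open Scope ereal_scope.
Context d (T : measurableType d) (R : realType).
Variable mu : {sigma_finite_measure set T -> \bar R}.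
Variables (dist : T -> T -> R) (A Q gamma : R).
Hypothesis mdist : measurable_fun setT (fun z : T * T => dist z.1 z.2).
Hypothesis dist_ge0 : forall x y, (0 <= dist x y)%R.
Hypothesis distC : forall x y, dist x y = dist y x.
Hypothesis ball_le : forall x (r : R), (0 < r)%R ->
  mu [set y | (dist x y < r)%R] <= (A * r `^ Q)%:E.
Hypotheses (A0 : (0 < A)%R) (gamma0 : (0 < gamma)%R) (gammaQ : (gamma < Q)%R).

Let mball := measurable_ball mdist.

(** Either [a <= tau], or [a = a ^ (1 - p) a ^ p <= tau ^ (1 - p) a ^ p] because [1 - p < 0]. *)
Let Young_le (tau p : R) (a : \bar R) : (0 < tau)%R -> (1 < p)%R -> 0 <= a ->
  a <= tau%:E + (tau `^ (1 - p))%:E * a `^ p.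
Proof.
move=> tau0 p1; case: a => [a| |]// a0; last first.
  by rewrite poweRyr ?gt_eqF ?(lt_trans _ p1)// gt0_muley ?lte_fin ?powR_gt0.
rewrite lee_fin in a0; rewrite poweR_EFin -EFinM -EFinD lee_fin.
have [atau|taua] := leP a tau.
  by rewrite (le_trans atau)// lerDl mulr_ge0 ?powR_ge0.
have a0' := lt_trans tau0 taua.
have -> : (a `^ p = a * a `^ (p - 1))%R by rewrite mulr_powRB1//; lra.
rewrite (_ : 1 - p = - (p - 1))%R ?powRN ?opprB// mulrCA.
apply: (@le_trans _ _ (a * 1)%R); first by rewrite mulr1.
apply: ler_wpDl; first exact: ltW.
rewrite ler_pM2l// mulrC ler_pdivlMr ?powR_gt0// mul1r.
by apply: ge0_ler_powR; rewrite ?nnegrE ?ltW ?subr_gt0.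
Qed.

(** The threshold [tau = W r ^ (- kappa)] in [Young_le] gives both terms the size
    [W r ^ (Q - kappa)], since [kappa p = Q - lam]; the volume contributes the factor [A] and the
    Morrey bound the factor 1. *)
Lemma morrey_growth (w : T -> \bar R) (p lam W : R) x (r : R) :
  (1 < p)%R -> (0 < W)%R -> (0 < r)%R ->
  measurable_fun setT w -> (forall y, 0 <= w y) ->
  \int[mu]_(y in [set y | (dist x y < r)%R]) w y `^ p <= (W `^ p * r `^ lam)%:E ->
  \int[mu]_(y in [set y | (dist x y < r)%R]) w y <=
  ((A + 1) * W * r `^ (Q - (Q - lam) / p))%:E.
Proof.
move=> p1 W0 r0 mw w0 wp.
have p0 : (0 < p)%R by lra.
set kappa := ((Q - lam) / p)%R.
pose tau := (W * r `^ (- kappa))%R.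
have tau0 : (0 < tau)%R by rewrite mulr_gt0 ?powR_gt0.
have mB := mball x r.
have mwp : measurable_fun setT (fun y => w y `^ p).
  exact: (measurableT_comp (measurable_poweR p) mw).
apply: (@le_trans _ _ (\int[mu]_(y in [set y | (dist x y < r)%R])
    (cst tau%:E y + (tau `^ (1 - p))%:E * w y `^ p))).
  apply: ge0_le_integral => //.
  - exact: measurable_funTS.
  - apply: emeasurable_funD => //; apply: measurable_funTS.
    by apply: emeasurable_funM => //; exact: measurable_cst.
  - by move=> y _; exact: Young_le.
rewrite ge0_integralD//; last 3 first.
- by move=> y _; rewrite lee_fin ltW.
- by move=> y _; rewrite mule_ge0 ?lee_fin ?powR_ge0// poweR_ge0.
- by apply: measurable_funTS; apply: emeasurable_funM => //; exact: measurable_cst.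
rewrite integral_cst// ge0_integralZl//; last 3 first.
- exact: measurable_funTS.
- by move=> y _; exact: poweR_ge0.
- by rewrite lee_fin powR_ge0.
apply: (@le_trans _ _ (tau%:E * (A * r `^ Q)%:E +
    (tau `^ (1 - p))%:E * (W `^ p * r `^ lam)%:E)).
  apply: leeD; rewrite lee_wpmul2l// ?lee_fin ?powR_ge0 ?(ltW tau0)//.
  exact: ball_le.
rewrite -!EFinM -EFinD lee_fin le_eqVlt; apply/orP; left; apply/eqP.
have -> : (lam = Q - kappa * p)%R by rewrite /kappa; field; rewrite gt_eqF.
rewrite /tau (powRM _ (ltW W0) (powR_ge0 _ _)) -powRrM.
have -> : (- kappa * (1 - p) = - kappa + kappa * p)%R by ring.
have -> : (W `^ p = W / W `^ (1 - p))%R.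
  rewrite -[X in (X / _)%R](powRr1 (ltW W0)) -powRN -gt0_powRD//.
  by congr powR; ring.
rewrite !gt0_powRD// !powRN; field.
by rewrite !gt_eqF ?powR_gt0.
Qed.

(** The first summand comes from the part of the function inside the ball enlarged by [K], the
    second from the far part; [2 ^ q] is the cost of separating them. *)
Definition morrey_cst (p q lam K : R) :=
  let kappa := ((Q - lam) / p)%R in
  (2 `^ q * (potential_cst A Q gamma p q kappa * (A + 1) `^ (q - p) * K `^ lam +
             (far_cst Q gamma kappa * (A + 1)) `^ q * A))%R.

Lemma morrey_cst_ge0 p q lam K : (1 < p)%R -> (0 <= morrey_cst p q lam K)%R.
Proof.
move=> p1; rewrite mulr_ge0 ?powR_ge0// addr_ge0//; last first.
  by rewrite mulr_ge0 ?powR_ge0// ltW.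
do 2![apply: mulr_ge0; last exact: powR_ge0].
exact: potential_cst_ge0.
Qed.

Let poweRD_le (q : R) (a b : \bar R) : (0 <= q)%R -> 0 <= a -> 0 <= b ->
  (a + b) `^ q <= (2 `^ q)%:E * (a `^ q + b `^ q).
Proof.
move=> q0 a0 b0.
have h x y : 0 <= x -> x <= y -> (x + y) `^ q <= (2 `^ q)%:E * (x `^ q + y `^ q).
  move=> x0 xy; have y0 := le_trans x0 xy.
  apply: (@le_trans _ _ ((2%:E * y) `^ q)).
    apply: ge0_le_poweR; rewrite ?adde_ge0//.
    by rewrite (_ : 2%:E = 1 + 1)// ge0_muleDl// !mul1e leeD2r.
  rewrite poweRM// poweR_EFin lee_wpmul2l ?lee_fin ?powR_ge0//.
  by rewrite leeDr// poweR_ge0.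
by case: (leP a b) => [/h|/ltW/h]; [|rewrite addeC [b `^ q + _]addeC]; exact.
Qed.

(** Inside the enlarged ball the global [L^q] bound applies to the restriction of [w]. The rest adds
    at most a constant [F] to the potential on the ball of radius [r], and
    [q (gamma - kappa) = lam - Q] makes the integral of [F ^ q] scale as [r ^ lam] too. *)
Lemma morrey_potential_le (w : T -> \bar R) (p q lam K W : R) :
  (1 < p)%R -> (p < q)%R -> (0 < lam)%R -> (lam < Q - gamma * p)%R ->
  (1 / q = 1 / p - gamma / (Q - lam))%R -> (0 < K)%R ->
  (forall x y z, dist x z <= K * Num.max (dist x y) (dist y z))%R ->
  (0 < W)%R -> measurable_fun setT w -> (forall y, 0 <= w y) ->
  (forall x (r : R), (0 < r)%R ->
   \int[mu]_(y in [set y | (dist x y < r)%R]) w y `^ p <= (W `^ p * r `^ lam)%:E) ->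
  forall x (r : R), (0 < r)%R ->
   \int[mu]_(y in [set y | (dist x y < r)%R]) potential mu dist Q gamma w y `^ q <=
     (morrey_cst p q lam K * W `^ q * r `^ lam)%:E.
Proof.
move=> p1 pq lam0 lamQ qE K0 quasi W0 mw w0 wp x0 r r0.
have p0 : (0 < p)%R by lra.
have q0 : (0 < q)%R by lra.
have gp0 : (0 < gamma * p)%R by rewrite mulr_gt0.
have Qlam : (0 < Q - lam)%R by lra.
pose kappa := ((Q - lam) / p)%R.
have gk : (gamma < kappa)%R by rewrite /kappa ltr_pdivlMr//; lra.
have kappa0 : (0 < kappa)%R by rewrite divr_gt0.
(* This is the relation defining [q], multiplied by [p]. *)
have thE : (1 - gamma / kappa = p / q)%R.
  have -> : (p / q = p * (1 / q))%R by rewrite div1r.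
  rewrite qE /kappa.
  by field; rewrite !gt_eqF.
have qk : (q * (gamma - kappa) = lam - Q)%R.
  have -> : (gamma - kappa = - kappa * (1 - gamma / kappa))%R.
    by field; rewrite gt_eqF.
  by rewrite thE /kappa; field; rewrite !gt_eqF.
have growth x s : (0 < s)%R -> \int[mu]_(y in [set y | (dist x y < s)%R]) w y <=
    ((A + 1) * W * s `^ (Q - kappa))%:E.
  by move=> s0; exact: (morrey_growth p1 W0 s0 mw w0 (wp x s s0)).
have A1 : (0 < A + 1)%R := addr_gt0 A0 ltr01.
have W1 : (0 < (A + 1) * W)%R by rewrite mulr_gt0.
(* By the quasi-triangle inequality, [dist x0 x < r] and [dist x y < r] put [y] in [B]. *)
pose B := [set y | (dist x0 y < K * r)%R].
have mB : measurable B := mball _ _.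
pose v := w \_ B.
have mv : measurable_fun setT v.
  by apply/(measurable_restrictT _ mB)/measurable_funTS.
have v0 y : 0 <= v y by rewrite /v patchE; case: ifP.
have vw y : v y <= w y by rewrite /v patchE; case: ifP.
have vgrowth x s : (0 < s)%R -> \int[mu]_(y in [set y | (dist x y < s)%R]) v y <=
    ((A + 1) * W * s `^ (Q - kappa))%:E.
  move=> s0; apply: le_trans (growth x s s0).
  apply: ge0_le_integral => //.
  - exact: measurable_funTS.
  - exact: measurable_funTS.
have Kr0 : (0 < K * r)%R by rewrite mulr_gt0.
have near_le : \int[mu]_x potential mu dist Q gamma v x `^ q <=
    (potential_cst A Q gamma p q kappa * ((A + 1) * W) `^ (q - p) *
     (W `^ p * (K * r) `^ lam))%:E.
  rewrite EFinM; apply: le_trans (integral_potential_powR_le mdist dist_ge0 distC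
    ball_le A0 gamma0 gammaQ p1 pq gk thE mv v0 W1 vgrowth) _.
  rewrite lee_wpmul2l//.
    by rewrite lee_fin mulr_ge0 ?powR_ge0// potential_cst_ge0.
  apply: le_trans (wp x0 _ Kr0); rewrite [leRHS]integral_mkcond.
  rewrite le_eqVlt; apply/orP; left; apply/eqP; apply: eq_integral => y _.
  rewrite /v !patchE; case: ifPn => //.
  by rewrite poweR0r// gt_eqF.
pose F := (far_cst Q gamma kappa * ((A + 1) * W) * r `^ (gamma - kappa))%R.
have F0 : (0 <= F)%R.
  apply: mulr_ge0 (powR_ge0 _ _); apply: mulr_ge0 (ltW W1).
  exact/ltW/far_cst_gt0.
have ker0 x y : 0 <= (dist x y `^ (gamma - Q))%:E by rewrite lee_fin powR_ge0.
have pot_ge0 f x : (forall y, 0 <= f y) -> 0 <= potential mu dist Q gamma f x.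
  by move=> f0; apply: integral_ge0 => y _; rewrite mule_ge0.
have mker x f : measurable_fun setT f ->
    measurable_fun setT (fun y => (dist x y `^ (gamma - Q))%:E * f y).
  move=> mf; apply: emeasurable_funM => //; apply/measurable_EFinP.
  apply: (measurableT_comp (measurable_powR _)).
  exact: (measurableT_comp mdist (pair1_measurable x)).
have split x : (dist x0 x < r)%R ->
    potential mu dist Q gamma w x <= potential mu dist Q gamma v x + F%:E.
  (* [B] and [C] cover the space, possibly with overlap, so [w] is at most the sum of its two
     restrictions. *)
  move=> xr; pose C := [set y | (r <= dist x y)%R].
  have mC : measurable C.
    apply/measurable_set_bool/measurable_fun_ler => //.
    exact: (measurableT_comp mdist (pair1_measurable x)).
  have mwC : measurable_fun setT (w \_ C).
    by apply/(measurable_restrictT _ mC)/measurable_funTS.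
  have wC0 y : 0 <= (w \_ C) y by rewrite patchE; case: ifP.
  apply: (@le_trans _ _ (potential mu dist Q gamma v x +
      potential mu dist Q gamma (w \_ C) x)).
    rewrite /potential -ge0_integralD//; last 4 first.
    - by move=> y _; rewrite mule_ge0.
    - exact: mker.
    - by move=> y _; rewrite mule_ge0.
    - exact: mker.
    apply: ge0_le_integral => //.
    - by move=> y _; rewrite mule_ge0.
    - exact: mker.
    - by apply: emeasurable_funD; exact: mker.
    move=> y _; rewrite -ge0_muleDr// lee_wpmul2l//.
    have [yC|yNC] := boolP (y \in C).
      by rewrite [(w \_ C) y]patchE yC leeDr.
    have yB : y \in B.
      move/negP: yNC; rewrite !inE /C/= => /negP; rewrite -ltNge => yr.
      rewrite /B/= (le_lt_trans (quasi _ x _))// ltr_pM2l//.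
      by rewrite gt_max xr yr.
    by rewrite /v patchE yB leeDl.
  apply: leeD => //.
  have -> : potential mu dist Q gamma (w \_ C) x =
      \int[mu]_(y in C) ((dist x y `^ (gamma - Q))%:E * w y).
    rewrite [RHS]integral_mkcond; apply: eq_integral => y _.
    by rewrite !patchE; case: ifP => // _; exact: mule0.
  exact: (far_kernel_le mdist dist_ge0 gammaQ mw w0 gk r0 (growth x)).
have mpot f : measurable_fun setT f -> (forall y, 0 <= f y) ->
    measurable_fun setT (fun x => potential mu dist Q gamma f x `^ q).
  move=> mf f0; apply: (measurableT_comp (measurable_poweR q)).
  exact: measurable_potential.
have mB0 := mball x0 r.
apply: (@le_trans _ _ (\int[mu]_(x in [set x | (dist x0 x < r)%R])
  ((2 `^ q)%:E * (potential mu dist Q gamma v x `^ q + cst (F `^ q)%:E x)))).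
  apply: ge0_le_integral => //.
  - by move=> x _; exact: poweR_ge0.
  - by apply: measurable_funTS; exact: mpot.
  - apply: measurable_funTS; apply: emeasurable_funM; first exact: measurable_cst.
    by apply: emeasurable_funD; [exact: mpot|exact: measurable_cst].
  - move=> x xr; apply: (@le_trans _ _ ((potential mu dist Q gamma v x + F%:E) `^ q)).
      apply: ge0_le_poweR; [exact: ltW|exact: pot_ge0|exact: split].
    by apply: poweRD_le; [exact: ltW|exact: pot_ge0|rewrite lee_fin].
rewrite ge0_integralZl//; last 2 first.
- apply: measurable_funTS.
  by apply: emeasurable_funD; [exact: mpot|exact: measurable_cst].
- by move=> x _; rewrite adde_ge0 ?poweR_ge0// lee_fin powR_ge0.
rewrite ge0_integralD//; last 3 first.
- by move=> x _; exact: poweR_ge0.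
- by apply: measurable_funTS; exact: mpot.
- by move=> x _; rewrite lee_fin powR_ge0.
rewrite integral_cst//.
apply: (@le_trans _ _ ((2 `^ q)%:E *
  ((potential_cst A Q gamma p q kappa * ((A + 1) * W) `^ (q - p) *
     (W `^ p * (K * r) `^ lam))%:E + (F `^ q)%:E * (A * r `^ Q)%:E))).
  rewrite lee_wpmul2l ?lee_fin ?powR_ge0//; apply: leeD.
    apply: le_trans near_le; apply: ge0_subset_integral => //; first exact: mpot.
    by move=> x _; exact: poweR_ge0.
  by rewrite lee_wpmul2l ?lee_fin ?powR_ge0//; exact: ball_le.
rewrite -[(F `^ q)%:E * _]EFinM -EFinD -EFinM lee_fin le_eqVlt; apply/orP; left; apply/eqP.
rewrite /morrey_cst -/kappa /F.
have := ltW (far_cst_gt0 Q gk).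
move: (potential_cst _ _ _ _ _ _) (far_cst _ _ _) => P c c0.
rewrite !mulrA !(powRM _ _ (powR_ge0 _ _)) ?mulr_ge0 ?(ltW A1) ?(ltW W0)//.
rewrite -powRrM [((gamma - kappa) * q)%R]mulrC qk.
rewrite !(powRM _ _ (ltW W0)) ?mulr_ge0 ?(ltW A1)// (powRM _ (ltW K0) (ltW r0)).
have -> : (W `^ q = W `^ (q - p) * W `^ p)%R by rewrite -gt0_powRD// subrK.
have -> : (r `^ lam = r `^ (lam - Q) * r `^ Q)%R by rewrite -gt0_powRD// subrK.
ring.
Qed.

End morrey_bound.

(** * Lebesgue measure on row vectors *)

Section open_measurable_rV.
Context {R : realType}.

(** The index of the half-open cube of side [1 / (n + 1)] containing [x]. *)
Let grid N n (x : 'rV[R]_N) : {ffun 'I_N -> int} :=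
  [ffun i => Num.floor (n.+1%:R * x ord0 i)].

Let measurable_grid N n (a : {ffun 'I_N -> int}) :
  measurable (@grid N n @^-1` [set a]).
Proof.
have -> : @grid N n @^-1` [set a] = \bigcap_(i in [set: 'I_N])
    [set x | (a i)%:~R <= n.+1%:R * rV_coord i x < (a i + 1)%:~R].
  apply/seteqP; split => [x /= <- i _|x /= xa].
    by rewrite ffunE; exact: floor_itv.
  by apply/ffunP => i; rewrite ffunE; apply: floor_def; exact: xa.
apply: fin_bigcap_measurable => // i _.
have mx : measurable_fun setT (fun x : 'rV[R]_N => n.+1%:R * rV_coord i x).
  by apply: measurable_funM => //; exact: measurable_rV_coord.
apply: measurable_set_bool; apply: measurable_and.
- exact: measurable_fun_ler.
- exact: measurable_fun_ltr.
Qed.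

Let grid_ball N n (x y : 'rV[R]_N) eps : n.+1%:R^-1 < eps ->
  grid n x = grid n y -> ball x eps y.
Proof.
move=> neps xy; split => [|i j]; first by apply: lt_trans neps; rewrite invr_gt0.
rewrite ord1; move/ffunP : xy => /(_ j); rewrite !ffunE => xy.
have := floor_itv (n.+1%:R * x ord0 j); have := floor_itv (n.+1%:R * y ord0 j).
rewrite xy intrD => /andP[y1 y2] /andP[x1 x2].
apply: lt_trans neps.
rewrite -[ltRHS]mul1r ltr_pdivlMr// mulrC -[X in X * _]ger0_norm// -normrM mulrBr.
rewrite ltr_norml; lra.
Qed.

(** The sigma-algebra is generated by the coordinates, not by the topology. An open set is the
    countable union of the products of grid cells that it contains. *)
Lemma open_measurable_rV2 N M (U : set ('rV[R]_N * 'rV[R]_M)) :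
  open U -> measurable U.
Proof.
rewrite openE => oU.
pose cell n (ab : {ffun 'I_N -> int} * {ffun 'I_M -> int}) :=
  (@grid N n @^-1` [set ab.1]) `*` (@grid M n @^-1` [set ab.2]).
pose F n ab := if `[< cell n ab `<=` U >] then cell n ab else set0.
have -> : U = \bigcup_n \bigcup_ab F n ab.
  apply/seteqP; split => [[x y] Uxy|z [n _ [ab _]]]; last first.
    by rewrite /F; case: asboolP => [h /h|_ []].
  have /nbhs_ballP[eps eps0 xyU] := oU _ Uxy.
  have [n] := ltr_add_invr eps0; rewrite add0r => neps.
  exists n => //; exists (grid n x, grid n y) => //.
  rewrite /F; case: asboolP => // -[] [x' y'] [/= xx' yy'].
  by apply: xyU; split; apply: (grid_ball neps).
apply: bigcupT_measurable => n.
apply: countable_bigcupT_measurable => [|ab]; first exact: countableP.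
rewrite /F; case: ifP => // _.
by apply: measurableX; exact: measurable_grid.
Qed.

Lemma open_measurable_rV N (U : set 'rV[R]_N) : open U -> measurable U.
Proof.
(* The cylinder over [U] is open in the product, and [U] is its section at 0. *)
move=> oU; have : measurable ((fun z : 'rV[R]_N * 'rV[R]_N => z.1) @^-1` U).
  by apply: open_measurable_rV2; apply: open_comp oU => z _; exact: cvg_fst.
move=> /(measurable_ysection (0 : 'rV[R]_N)); congr measurable.
by apply/seteqP; split => x; rewrite /ysection/= inE.
Qed.

Lemma continuous_measurable_rV2 N M (f : 'rV[R]_N * 'rV[R]_M -> R) :
  continuous f -> measurable_fun setT f.
Proof.
move=> /continuousP cf; apply: (measurability _ (RGenOpens.measurableE R)).
move=> _ [_ [a [b ->] <-]]; rewrite setTI; apply: open_measurable_rV2.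
exact/cf/interval_open.
Qed.

Lemma continuous_measurable_rV N (f : 'rV[R]_N -> R) :
  continuous f -> measurable_fun setT f.
Proof.
move=> /continuousP cf; apply: (measurability _ (RGenOpens.measurableE R)).
move=> _ [_ [a [b ->] <-]]; rewrite setTI; apply: open_measurable_rV.
exact/cf/interval_open.
Qed.

End open_measurable_rV.

Lemma lebesgue_measure_translation (R : realType) (c : R) (A : set R) :
  measurable A -> lebesgue_measure ((+%R^~ c) @^-1` A) = lebesgue_measure A.
Proof.
move=> mA.
have mc : measurable_fun setT (+%R^~ c : measurableTypeR R -> measurableTypeR R).
  by apply: measurable_funD => //.
apply/esym; rewrite -[RHS]/(pushforward (@lebesgue_measure R)
  (+%R^~ c : measurableTypeR R -> measurableTypeR R) A).
apply: lebesgue_measure_unique => // _ [[a b] _ <-].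
rewrite /pushforward.
rewrite [X in _ = lebesgue_measure X](_ : _ = `](a - c), (b - c)]%classic); last first.
  by apply/seteqP; split => x /=; rewrite !in_itv/= ltrBlDr lerBrDr.
rewrite !lebesgue_measure_itv/= !lte_fin ltrD2r; case: ifP => // _.
by rewrite -!EFinD opprD opprK addrACA addNr addr0.
Qed.

Section cons_rV_coord.
Context {R : realType} {n : nat}.

Lemma cons_rV0 (z : R * 'rV[R]_n) : cons_rV z ord0 ord0 = z.1.
Proof.
rewrite /cons_rV (_ : ord0 = @lshift 1 n ord0 :> 'I_n.+1); last exact/val_inj.
by apply: etrans (row_mxEl _ _ _ _) _; rewrite mxE eqxx.
Qed.

Lemma cons_rVS (z : R * 'rV[R]_n) k : cons_rV z ord0 (lift ord0 k) = z.2 ord0 k.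
Proof.
rewrite /cons_rV (_ : lift ord0 k = @rshift 1 n k :> 'I_n.+1); last exact/val_inj.
exact: row_mxEr.
Qed.

Lemma rV_consP (x y : 'rV[R]_n.+1) : x ord0 ord0 = y ord0 ord0 ->
  (forall k, x ord0 (lift ord0 k) = y ord0 (lift ord0 k)) -> x = y.
Proof.
move=> xy0 xyS; apply/rowP => i.
by have [k ->|->] := unliftP ord0 i.
Qed.

Lemma cons_rVD0 a (w : 'rV[R]_n) c :
  cons_rV (a, w) + c *: delta_mx ord0 ord0 = cons_rV (a + c, w).
Proof.
apply: rV_consP => [|k]; rewrite [LHS]mxE [X in _ + X]mxE [X in _ + _ * X]mxE.
  by rewrite !cons_rV0/= mulr1.
by rewrite !cons_rVS/= mulr0 addr0.
Qed.

Lemma cons_rVDS a (w : 'rV[R]_n) c k :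
  cons_rV (a, w) + c *: delta_mx ord0 (lift ord0 k) =
  cons_rV (a, w + c *: delta_mx ord0 k).
Proof.
apply: rV_consP => [|j]; rewrite [LHS]mxE [X in _ + X]mxE [X in _ + _ * X]mxE.
  by rewrite !cons_rV0/= mulr0 addr0.
by rewrite !cons_rVS/= !mxE/= (inj_eq lift_inj).
Qed.

End cons_rV_coord.

(** * Shears preserve Lebesgue measure *)

Section shear.
Context {R : realType}.

Definition shear N (i : 'I_N) (g : 'rV[R]_N -> R) (z : 'rV[R]_N) : 'rV[R]_N :=
  z + g z *: delta_mx ord0 i.

Lemma measurable_shear N (i : 'I_N) g : measurable_fun setT g ->
  measurable_fun setT (shear i g).
Proof.
move=> mg; apply: measurable_fun_rVP => j.
rewrite (_ : _ \o _ = rV_coord j \+ (fun z => g z * (j == i)%:R)); last first.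
  by apply/funext => z; rewrite /rV_coord /shear/= !mxE.
apply: measurable_funD; first exact: measurable_rV_coord.
by apply: measurable_funM.
Qed.

(** Induction along the recursive construction of [lebesgue_rV]. A shear of a later coordinate acts
    as a shear on each slice with fixed first coordinate; a shear of the first coordinate translates
    each slice on which the other coordinates are fixed. *)
Lemma lebesgue_rV_shear N (i : 'I_N) g (A : set 'rV[R]_N) :
  measurable_fun setT g -> (forall z c, g (z + c *: delta_mx ord0 i) = g z) ->
  measurable A ->
  lebesgue_rV R N (shear i g @^-1` A) = lebesgue_rV R N A.
Proof.
elim: N i g A => [[]//|N IH] i g A mg gi mA.
have mS : measurable (@shear N.+1 i g @^-1` A).
  by rewrite -[X in measurable X]setTI; exact: measurable_shear.
have mcons (B : set 'rV[R]_N.+1) : measurable B -> measurable (@cons_rV R N @^-1` B).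
  by move=> mB; rewrite -[X in measurable X]setTI; exact: measurable_cons_rV.
rewrite /= /lebesgue_rV_step /pushforward.
have [k ik|i0] := unliftP ord0 i.
  apply: eq_integral => a _ /=.
  have -> : xsection (@cons_rV R N @^-1` (@shear N.+1 i g @^-1` A)) a =
      shear k (fun w => g (cons_rV (a, w))) @^-1` xsection (@cons_rV R N @^-1` A) a.
    by apply/seteqP; split => w; rewrite /xsection/= !inE/= /shear ik cons_rVDS.
  apply: IH.
  - apply: measurableT_comp mg _; apply: measurableT_comp (@measurable_cons_rV R N) _.
    exact: pair1_measurable.
  - by move=> w c; rewrite -cons_rVDS -ik gi.
  - by apply: measurable_xsection; exact: mcons.
(* Fixing the remaining coordinates [w] instead of the first one requires the other order of
   integration. *)
have pE (B : set (R * 'rV[R]_N)) : measurable B ->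
    (@lebesgue_measure R \x lebesgue_rV R N)%E B =
    (@lebesgue_measure R \x^ lebesgue_rV R N)%E B.
  move=> mB; apply: product_measure_unique => // B1 B2 mB1 mB2.
  exact: product_measure2E.
rewrite !pE; [|exact: mcons|exact: mcons].
apply: eq_integral => w _ /=.
have -> : ysection (@cons_rV R N @^-1` (@shear N.+1 i g @^-1` A)) w =
    (+%R^~ (g (cons_rV (0, w)))) @^-1` ysection (@cons_rV R N @^-1` A) w.
  have gE a : g (cons_rV (a, w)) = g (cons_rV (0, w)).
    by rewrite -[a in LHS]add0r -cons_rVD0 -i0 gi.
  by apply/seteqP; split => a; rewrite /ysection/= !inE/= /shear i0 (gE a) cons_rVD0.
rewrite lebesgue_measure_translation//.
by apply: measurable_ysection; exact: mcons.
Qed.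

End shear.

(** * The group law and the quasi-norm *)

Lemma ler_coord_norm (R : realType) N (x : 'rV[R]_N) k : `|x ord0 k| <= `|x|.
Proof. by rewrite [leRHS]mx_normrE (le_bigmax _ _ (ord0, k)). Qed.

Section directional.
Context {R : realType}.

(** Reduces a directional derivative to the derivative of a scalar function of one variable, ready
    for the mean value theorem. *)
Lemma is_derive_coord_line (V : normedModType R) N (f : V -> 'rV[R]_N)
    (z w : V) (i : 'I_N) (s : R) : derivable f (z + s *: w) w ->
  is_derive s 1 (fun a : R => f (z + a *: w) ord0 i)
    ('D_w f (z + s *: w) ord0 i).
Proof.
move=> df.
have cv : (h^-1 *: ((f \o shift (z + s *: w)) (h *: w) - f (z + s *: w)))
    ord0 i @[h --> 0^'] --> 'D_w f (z + s *: w) ord0 i.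
  apply: (@continuous_cvg _ _ _ _ _ _ (fun M : 'rV[R]_N => M ord0 i)).
    exact: coord_continuous.
  exact: df.
have cvE : h^-1 *: (((fun a : R => f (z + a *: w) ord0 i) \o shift s) (h *: 1)
    - f (z + s *: w) ord0 i) @[h --> 0^'] --> 'D_w f (z + s *: w) ord0 i.
  apply: cvg_trans cv; apply: near_eq_cvg; apply: nearW => h /=.
  by rewrite !mxE scalerDl -[h *: 1]mulr1 /GRing.scale/= !mulr1 addrCA.
by apply: DeriveDef; [apply/cvg_ex; eexists; exact: cvE|exact: cvg_lim cvE].
Qed.

End directional.

(** * Left translations preserve Lebesgue measure *)

Section group_law.
Context {R : realType} {N : nat} (G : homogeneousGroup R N).
Let nu := hg_weight G.
Let nu_gt0 i : 0 < nu i. Proof. exact: hg_weight_gt0. Qed.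
Let mul := lg_mul G.
Let mul2 (z : 'rV[R]_N * 'rV[R]_N) := mul z.1 z.2.

Lemma hg_dilE t (x : 'rV[R]_N) i :
  hg_dil G t x ord0 i = t `^ (nu i) * x ord0 i.
Proof. by rewrite mxE. Qed.

(** The dilation by 2 is multiplicative, so it sends the identity to an idempotent, which is the
    identity. As 2 to the power [nu i] differs from 1, a fixed point has all coordinates 0. *)
Lemma lg_one0 : lg_one G = 0.
Proof.
have idem : hg_dil G 2 (lg_one G) = lg_one G.
  set e := hg_dil G 2 (lg_one G).
  have ee : lg_mul G e e = e by rewrite -hg_dilationM// lg_mul1.
  by rewrite -[LHS](lg_mul1 G) -[X in lg_mul G X _](lg_mulV G e) -lg_mulA ee lg_mulV.
apply/rowP => i; move/rowP : idem => /(_ i).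
rewrite hg_dilE mxE => /eqP; rewrite -subr_eq0 -[X in _ - X]mul1r -mulrBl mulf_eq0.
case/orP => [|/eqP//]; rewrite subr_eq0 powR_eq1.
by rewrite (gt_eqF (nu_gt0 i)) ltNge ler0n /= gt_eqF// ltr1n.
Qed.

Let mul2_diff z : differentiable mul2 z.
Proof. by have [] := lg_mul_smooth G 1%N. Qed.

Let mul2_derive_continuous w : continuous ('D_w mul2).
Proof. by have [_] := lg_mul_smooth G 1%N; exact. Qed.

Lemma lg_mul_continuous : continuous (fun z : 'rV[R]_N * 'rV[R]_N => lg_mul G z.1 z.2).
Proof. by move=> z; exact: differentiable_continuous (mul2_diff z). Qed.

Let increment h j (x y : 'rV[R]_N) i :=
  mul x (y + h *: delta_mx ord0 j) ord0 i - mul x y ord0 i.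

Let direction h j : 'rV[R]_N * 'rV[R]_N := (0, h *: delta_mx ord0 j).

(* Dilating by [t] turns the increment at [(x, y)] into one near the origin. *)
Let increment_mvt h i j x y (t : R) : 0 < t ->
  exists2 c, c \in `[0, t `^ nu j] &
  increment h j x y i = t `^ (nu j - nu i) *
    ('D_(direction h j) mul2 ((hg_dil G t x, hg_dil G t y) + c *: direction h j)) ord0 i.
Proof.
move=> t0; set w := direction h j; set z := (hg_dil G t x, hg_dil G t y).
have dpsi (s : R) : is_derive s (1 : R) (fun a : R => mul2 (z + a *: w) ord0 i)
    ('D_w mul2 (z + s *: w) ord0 i).
  by apply: is_derive_coord_line; exact: diff_derivable.
have [|c cin] := @MVT_segment R (fun a : R => mul2 (z + a *: w) ord0 i) _
  0 (t `^ nu j) (powR_ge0 _ _) (fun s _ => dpsi s).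
  apply: continuous_subspaceT => s.
  by apply: differentiable_continuous; apply/derivable1_diffP; exact: ex_derive.
rewrite subr0 scale0r addr0 => E; exists c => //.
(* The mean value theorem was applied to the dilated product, whose increment in coordinate [i] is
   [t ^ nu i] times the original one. *)
apply: (mulfI (lt0r_neq0 (powR_gt0 (nu i) t0))).
rewrite [RHS]mulrA -gt0_powRD// addrCA subrr addr0 [RHS]mulrC -E /increment mulrBr.
rewrite -!hg_dilE /mul2/= scaler0 addr0 /mul.
rewrite /hg_dil !hg_dilationM//; congr (lg_mul G _ _ ord0 i - _).
apply/rowP => k; rewrite !mxE mulrDr; congr (_ + _).
have [->|_] := eqVneq k j; first by rewrite !mulr1.
by rewrite !mulr0.
Qed.

(** As [t] tends to 0 the dilated points and the intermediate point tend to the origin, where the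
    derivative is continuous; [nu i <= nu j] keeps the factor [t ^ (nu j - nu i)] at most 1. *)
Let increment_near h i j x y eps : 0 < eps -> nu i <= nu j ->
  \forall t \near 0^'+, `|increment h j x y i -
    t `^ (nu j - nu i) * ('D_(direction h j) mul2 0) ord0 i| <= eps.
Proof.
move=> eps0 ij; set w := direction h j.
have : (fun z => 'D_w mul2 z ord0 i) @ (0 : 'rV[R]_N * 'rV[R]_N) -->
    'D_w mul2 0 ord0 i.
  apply: (@continuous_cvg _ _ _ _ _ _ (fun M : 'rV[R]_N => M ord0 i)).
    exact: coord_continuous.
  exact: mul2_derive_continuous.
move=> /cvgrPdist_le /(_ _ eps0) /nbhs_ballP[del /= del0 Dball].
(* [M] bounds the coordinates of [x], [y] and the displacement together, so after dilation the
   [k]-th ones are below [t ^ nu k * M]; the 1 keeps [M] positive. *)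
pose M := `|x| + `|y| + `|h| + 1.
have M0 : 0 < M by rewrite ltr_wpDl// !addr_ge0.
have small : \forall t \near 0^'+, forall k : 'I_N, t `^ nu k * M < del.
  apply: filter_forall => k.
  have := powR_cvg0 (nu_gt0 k) => /cvgr0Pnorm_lt /(_ (del / M)).
  rewrite divr_gt0// => /(_ isT); apply: filterS => t.
  by rewrite ger0_norm ?powR_ge0// ltr_pdivlMr.
near=> t.
have t0 : 0 < t by near: t; exact: nbhs_right_gt.
have t1 : t <= 1 by near: t; exact: nbhs_right_le.
have tM k : t `^ nu k * M < del by move: k; near: t.
have [c cin ->] := increment_mvt h i j x y t0.
rewrite -mulrBr normrM ger0_norm ?powR_ge0//.
rewrite -[leRHS]mul1r; apply: ler_pM; rewrite ?powR_ge0//.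
  by rewrite -[leRHS](powRr0 t) ger_powR ?t0 ?subr_ge0.
rewrite distrC; apply: Dball.
have tk k a b : `|a| + `|b| <= M -> 0 <= c <= t `^ nu k \/ b = 0 ->
    `|t `^ nu k * a + c * b| < del.
  move=> abM cb; apply: le_lt_trans (tM k).
  apply: (@le_trans _ _ (t `^ nu k * (`|a| + `|b|))); last first.
    by rewrite ler_wpM2l ?powR_ge0.
  rewrite mulrDr (le_trans (ler_normD _ _))// !normrM ger0_norm ?powR_ge0// lerD2l.
  case: cb => [/andP[c0 cle]|->]; last by rewrite normr0 !mulr0.
  by rewrite ger0_norm// ler_wpM2r.
move: cin; rewrite in_itv/= => cin.
have xM k := ler_coord_norm x k; have yM k := ler_coord_norm y k.
split; split=> [//|k l]; rewrite ord1.
- suff : `|t `^ nu l * x ord0 l + c * 0| < del.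
    by rewrite /ball/= !mxE sub0r normrN.
  apply: tk; last by right.
  rewrite normr0 addr0 (le_trans (xM l))// /M -!addrA lerDl.
  by rewrite !addr_ge0.
- suff : `|t `^ nu l * y ord0 l + c * (h * (l == j)%:R)| < del.
    by rewrite /ball/= !mxE sub0r normrN.
  apply: tk.
    rewrite /M -addrA; apply: lerD; last first.
      rewrite ler_wpDr// normrM ler_piMr// normr_nat.
      by case: (l == j).
    by rewrite (le_trans (yM l))// lerDr.
  have [->|_] := eqVneq l j; [by left|by right; rewrite mulr0].
Unshelve. all: by end_near.
Qed.

(** In [increment_near] the approximating term does not depend on the base point, so the increments
    at [(x, y)] and at the origin coincide; at the origin left multiplication is by the identity. *)
Lemma lg_mul_increment h i j (x y : 'rV[R]_N) : nu i <= nu j ->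
  lg_mul G x (y + h *: delta_mx ord0 j) ord0 i =
  lg_mul G x y ord0 i + h * (i == j)%:R.
Proof.
move=> ij.
suff E : increment h j x y i = increment h j 0 0 i.
  have -> : h * (i == j)%:R = increment h j 0 0 i.
    by rewrite /increment /mul -lg_one0 !lg_mul1 lg_one0 !mxE add0r subr0.
  by rewrite -E /increment [RHS]addrC subrK.
apply/eqP; rewrite -subr_eq0 -normr_le0; apply/ler_addgt0Pl => eps eps0.
rewrite addr0; have eps20 : 0 < eps / 2 by rewrite divr_gt0.
near (0 : R)^'+ => t.
have h1 : `|increment h j x y i -
    t `^ (nu j - nu i) * ('D_(direction h j) mul2 0) ord0 i| <= eps / 2.
  by near: t; exact: increment_near.
have h2 : `|increment h j 0 0 i -
    t `^ (nu j - nu i) * ('D_(direction h j) mul2 0) ord0 i| <= eps / 2.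
  by near: t; exact: increment_near.
move: h1 h2; set L := t `^ _ * _ => h1 h2.
rewrite -(subrKA L) -[X in _ + X]opprB (le_trans (ler_normB _ _))//; lra.
Unshelve. all: by end_near.
Qed.

(** The correction that left translation by [x] adds to coordinate [i]; it will serve as the
    displacement of a shear. *)
Let defect x i (y : 'rV[R]_N) := lg_mul G x y ord0 i - y ord0 i.

Let defectD x i y h j : nu i <= nu j ->
  defect x i (y + h *: delta_mx ord0 j) = defect x i y.
Proof.
move=> ij; rewrite /defect lg_mul_increment// !mxE/=.
by rewrite opprD addrACA subrr addr0.
Qed.

(** Pass from [y] to [y'] one coordinate at a time: those of weight at least [nu i] do not affect
    the defect by [defectD], and the lighter ones already agree. *)
Let defect_eq x i (y y' : 'rV[R]_N) : (forall k, nu k < nu i -> y ord0 k = y' ord0 k) ->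
  defect x i y = defect x i y'.
Proof.
move=> yy'.
pose z (s : seq 'I_N) : 'rV[R]_N := \row_k (if k \in s then y' ord0 k else y ord0 k).
have zE s : defect x i (z s) = defect x i y.
  elim: s => [|j s IH]; first by congr defect; apply/rowP => k; rewrite mxE.
  have zj : z (j :: s) = z s + (z (j :: s) - z s) ord0 j *: delta_mx ord0 j.
    apply/rowP => k; rewrite !mxE !inE eqxx/=.
    have [->|kj] /= := eqVneq k j; first by rewrite mulr1 addrC subrK.
    by rewrite mulr0 addr0.
  have [ij|ji] := leP (nu i) (nu j); first by rewrite zj defectD.
  rewrite zj -IH; congr defect.
  rewrite !mxE !inE eqxx/= (yy' _ ji) (fun_if id); case: ifP; rewrite subrr scale0r addr0 //.
rewrite -(zE (enum 'I_N)); congr defect; apply/rowP => k.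
by rewrite mxE mem_enum.
Qed.

Let measurable_defect x i : measurable_fun setT (defect x i).
Proof.
apply: continuous_measurable_rV => y; apply: continuousB; last exact: coord_continuous.
apply: (@continuous_comp _ _ _ (fun y => lg_mul G x y)
  (fun M : 'rV[R]_N => M ord0 i)); last exact: coord_continuous.
apply: (@continuous_comp _ _ _ (fun y => (x, y)) mul2); last first.
  exact: differentiable_continuous (mul2_diff _).
exact: (@cvg_pair _ _ _ (nbhs y) (nbhs x) (nbhs y) _ _ _ (fun=> x) id (@cvg_cst _ _ _ _ _) cvg_id).
Qed.

Let partial_mul x (s : seq 'I_N) (y : 'rV[R]_N) : 'rV[R]_N :=
  \row_k (if k \in s then lg_mul G x y ord0 k else y ord0 k).

(* [partial_mul x s] has already translated the coordinates in [s]. If [s] contains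
   only coordinates of weight at least that of [i], the defect of [i] is unaffected,
   so translating one more coordinate amounts to a shear. *)
Lemma lebesgue_rV_lg_mul x (A : set 'rV[R]_N) : measurable A ->
  lebesgue_rV R N (lg_mul G x @^-1` A) = lebesgue_rV R N A.
Proof.
move=> mA.
have inv s : uniq s -> sorted (relpre nu <=%R) s -> forall B, measurable B ->
    lebesgue_rV R N (partial_mul x s @^-1` B) = lebesgue_rV R N B.
  elim: s => [_ _ B mB|i s IH /= /andP[ins us] iss B mB].
    by congr (lebesgue_rV R N _); apply/seteqP; split => y /=;
      rewrite (_ : partial_mul x [::] y = y)//; apply/rowP => k; rewrite mxE.
  have le_i j : j \in s -> nu i <= nu j.
    have tr : transitive (relpre nu <=%R) by move=> a b c; exact: le_trans.
    by move/(order_path_min tr)/allP : iss; exact.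
  have -> : partial_mul x (i :: s) @^-1` B =
      partial_mul x s @^-1` (shear i (defect x i) @^-1` B).
    suff e y : partial_mul x (i :: s) y = shear i (defect x i) (partial_mul x s y).
      by apply/seteqP; split => y /=; rewrite e.
    have dE : defect x i (partial_mul x s y) = defect x i y.
      apply: defect_eq => k ki; rewrite mxE; case: ifP => // /le_i.
      by rewrite leNgt ki.
    apply/rowP => k; rewrite /shear dE !mxE inE.
    have [->|_] /= := eqVneq k i; last by rewrite mulr0 addr0.
    by rewrite (negbTE ins) mulr1 /defect addrC subrK.
  have mS : measurable (shear i (defect x i) @^-1` B).
    by rewrite -[X in measurable X]setTI; exact: measurable_shear.
  rewrite (IH us (path_sorted iss) _ mS); apply: lebesgue_rV_shear => //.
  by move=> y h; exact: defectD.
(* In order of increasing weight the last, heaviest coordinate is sheared first, and each head of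
   the list weighs no more than the coordinates already translated. *)
pose s := sort (relpre nu <=%R) (enum 'I_N).
rewrite -(inv s _ _ A mA).
- congr (lebesgue_rV R N _); apply/seteqP; split => y /=;
    rewrite (_ : partial_mul x s y = lg_mul G x y)//; apply/rowP => k;
    by rewrite mxE mem_sort mem_enum.
- by rewrite sort_uniq enum_uniq.
- by apply: sort_sorted => i j; exact: le_total.
Qed.

End group_law.

Lemma measurable_rV_box (R : realType) N (M : 'I_N -> R) :
  measurable [set y : 'rV[R]_N | forall i, `|y ord0 i| <= M i].
Proof.
have -> : [set y : 'rV[R]_N | forall i, `|y ord0 i| <= M i] =
  \bigcap_(i in [set: 'I_N]) [set y | `|rV_coord i y| <= M i].
  by apply/seteqP; split => y yM i; [move=> _|]; exact: yM.
apply: fin_bigcap_measurable => // i _.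
apply/measurable_set_bool/measurable_fun_ler => //.
apply: (measurableT_comp (@normr_measurable _ _)).
exact: measurable_rV_coord.
Qed.

Lemma lebesgue_rV_box_le (R : realType) N (M : 'I_N -> R) : (forall i, 0 <= M i) ->
  (lebesgue_rV R N [set y : 'rV[R]_N | forall i, (`|y ord0 i| <= M i)%R] <=
   (\prod_(i < N) (2 * M i))%:E)%E.
Proof.
elim: N M => [|N IH] M M0; first by rewrite big_ord0 /= /dirac lee_fin indicE; case: (_ \in _).
rewrite big_ord_recl /= /lebesgue_rV_step /pushforward.
rewrite [X in product_measure1 _ _ X](_ : _ = `[- M ord0, M ord0] `*`
    [set w : 'rV[R]_N | forall i, `|w ord0 i| <= M (lift ord0 i)]); last first.
  apply/seteqP; split => -[a w]/=; rewrite in_itv/= -ler_norml.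
    move=> awM; split; first by have := awM ord0; rewrite cons_rV0.
    by move=> i; have := awM (lift ord0 i); rewrite cons_rVS.
  move=> [aM wM] i; have [k ->|->] := unliftP ord0 i; last by rewrite cons_rV0.
  by rewrite cons_rVS.
have mbox := measurable_rV_box (fun i => M (lift ord0 i)).
rewrite product_measure1E// EFinM; apply: lee_pmul => //.
  apply: (@le_trans _ _ (lebesgue_measure `[(- M ord0), M ord0]%classic)) => //.
  rewrite lebesgue_measure_itv/=; case: ifP => _.
    by rewrite -EFinB lee_fin opprK mulr_natl mulr2n.
  by rewrite lee_fin mulr_ge0.
by apply: IH.
Qed.

(** * The quasi-norm and the volume of quasi-balls *)

Section quasi_norm.
Context {R : realType} {N : nat} {G : homogeneousGroup R N} (nrm : quasiNorm G).
Let nu := hg_weight G.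
Let nu_gt0 i : 0 < nu i. Proof. exact: hg_weight_gt0. Qed.

Let nrm_continuous : continuous nrm. Proof. exact: qnorm_continuous. Qed.

(** [m] is the minimum of the quasi-norm on the unit sphere of the sup norm, positive because the
    identity 0 is not on it. Dilating [x] by the inverse of the largest [|x_l| ^ (1 / nu l)] lands
    on that sphere, and homogeneity gives the bound. *)
Lemma qnorm_coord_le : exists2 m : R, 0 < m &
  forall (x : 'rV[R]_N) k, `|x ord0 k| <= (nrm x / m) `^ nu k.
Proof.
pose S := [set x : 'rV[R]_N | `|x| = 1].
have cS : compact S.
  apply: bounded_closed_compact.
    by exists 1; split => // M M1 x /= ->; exact: ltW.
  apply: (@preimage_closed _ _ (fun x : 'rV[R]_N => `|x|) [set 1]).
    by move=> x _; exact: norm_continuous.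
  exact: closed_eq.
(* Without coordinates the sphere is empty, and any [m] will do. *)
have [i0 _|] := pickP (fun i : 'I_N => true); last first.
  by move=> N0; exists 1 => // x k; have := N0 k.
have norm1 (x : 'rV[R]_N) k : (forall l, `|x ord0 l| <= 1) -> `|x ord0 k| = 1 -> S x.
  move=> x1 xk; rewrite /S/=; apply/eqP; rewrite eq_le -{2}xk ler_coord_norm andbT.
  rewrite [leLHS]mx_normrE; apply/bigmax_leP; split => // -[a l] _ /=.
  by rewrite ord1.
have S0 : S !=set0.
  exists (delta_mx ord0 i0); apply: (norm1 _ i0) => [l|]; rewrite mxE eqxx/=.
    by rewrite normr_nat; case: (l == i0).
  by rewrite eqxx normr1.
have [c /set_mem cc cmin] := EVT_min_rV S0 cS (continuous_subspaceT nrm_continuous).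
have m0 : 0 < nrm c.
  rewrite lt_neqAle qnorm_ge0 andbT eq_sym; apply/eqP => /qnorm_eq0.
  rewrite lg_one0 => c0; move: cc; rewrite /S/= c0 normr0 => /esym/eqP.
  by rewrite oner_eq0.
exists (nrm c) => // x k.
pose a l := `|x ord0 l| `^ (nu l)^-1.
have a0 l : 0 <= a l by exact: powR_ge0.
have aE l : `|x ord0 l| = a l `^ nu l.
  by rewrite /a -powRrM mulVf ?gt_eqF// powRr1.
case: (@arg_maxP _ _ _ i0 predT a isT) => i _ amax.
rewrite aE; apply: (@le_trans _ _ (a i `^ nu k)).
  by apply: ge0_ler_powR; rewrite ?nnegrE ?(ltW (nu_gt0 k))//; exact: amax.
apply: ge0_ler_powR; rewrite ?nnegrE ?(ltW (nu_gt0 k))//.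
  by rewrite divr_ge0 ?qnorm_ge0.
have := a0 i; rewrite le_eqVlt => /predU1P[<-|ai0].
  by rewrite divr_ge0 ?qnorm_ge0.
rewrite ler_pdivlMr// -ler_pdivlMl// -qnormZ ?invr_gt0//.
apply: cmin; apply/mem_set; apply: (norm1 _ i) => [l|].
  rewrite hg_dilE normrM aE ger0_norm ?powR_ge0// -powR_inv1// -powRrM mulN1r powRN.
  rewrite mulrC ler_pdivrMr ?(powR_gt0 _ ai0)// mul1r.
  by apply: ge0_ler_powR; rewrite ?nnegrE ?(ltW (nu_gt0 l))//; exact: amax.
rewrite hg_dilE normrM aE ger0_norm ?powR_ge0// -powR_inv1// -powRrM mulN1r powRN.
by rewrite mulVf// gt_eqF// (powR_gt0 _ ai0).
Qed.

(** By [qnorm_coord_le] the quasi-norm unit ball lies in a compact set, on whose square the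
    quasi-norm of the product is bounded; dilations extend the bound to all pairs. *)
Lemma qnormM_le : exists2 K : R, 0 < K &
  forall x y, nrm (lg_mul G x y) <= K * Num.max (nrm x) (nrm y).
Proof.
have [m m0 coordm] := qnorm_coord_le.
pose M := \sum_(k < N) m^-1 `^ nu k.
have M0 : 0 <= M by apply: sumr_ge0 => k _; exact: powR_ge0.
pose B := [set x : 'rV[R]_N | `|x| <= M].
have nrmB x : nrm x <= 1 -> B x.
  move=> x1; rewrite /B/= [leLHS]mx_normrE; apply/bigmax_leP; split => // -[a l] _ /=.
  rewrite ord1 (le_trans (coordm _ _))//.
  apply: (@le_trans _ _ (m^-1 `^ nu l)).
    apply: ge0_ler_powR;
      rewrite ?nnegrE ?(ltW (nu_gt0 l)) ?divr_ge0 ?qnorm_ge0 ?invr_ge0 ?(ltW m0)//.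
    by rewrite ler_pdivrMr// mulVf ?gt_eqF.
  rewrite /M (bigD1 l)//= lerDl; apply: sumr_ge0 => k _; exact: powR_ge0.
have cB : compact B.
  apply: bounded_closed_compact.
    by exists M; split => [|C MC x /= xM]; [exact: num_real|exact: le_trans xM (ltW MC)].
  apply: (@preimage_closed _ _ (fun x : 'rV[R]_N => `|x|) [set a | a <= M]).
    by move=> x _; exact: norm_continuous.
  exact: closed_le.
have B0 : B `*` B !=set0 by exists (0, 0); split; rewrite /B/= normr0.
have cf : continuous (fun z : 'rV[R]_N * 'rV[R]_N => nrm (lg_mul G z.1 z.2)).
  move=> z; apply: (@continuous_comp _ _ _
    (fun z : 'rV[R]_N * 'rV[R]_N => lg_mul G z.1 z.2) nrm).
    exact: lg_mul_continuous.
  exact: nrm_continuous.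
have [c _ cmax] := compact_EVT_max B0 (compact_setX cB cB) (continuous_subspaceT cf).
pose K := nrm (lg_mul G c.1 c.2) + 1.
have K0 : 0 < K by rewrite ltr_wpDl// qnorm_ge0.
exists K => // x y; set r := Num.max _ _.
have xr : nrm x <= r by rewrite le_max lexx.
have yr : nrm y <= r by rewrite le_max lexx orbT.
(* When [r = 0] no rescaling is possible, but then [x] is the identity. *)
have := le_trans (qnorm_ge0 nrm x) xr; rewrite le_eqVlt => /predU1P[r0|r0].
  have /qnorm_eq0 -> : nrm x = 0 by apply/eqP; rewrite eq_le qnorm_ge0 andbT r0.
  by rewrite lg_mul1 (le_trans yr)// -r0 mulr0.
have ri0 : 0 < r^-1 by rewrite invr_gt0.
have dilB z : nrm z <= r -> B (hg_dil G r^-1 z).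
  by move=> zr; apply: nrmB; rewrite qnormZ// ler_pdivrMl// mulr1.
have := cmax (hg_dil G r^-1 x, hg_dil G r^-1 y).
rewrite inE => /(_ (conj (dilB _ xr) (dilB _ yr)))/=.
rewrite /hg_dil -hg_dilationM// -/(hg_dil G _ _) qnormZ// ler_pdivrMl// => h.
by rewrite (le_trans h)// mulrC ler_pM2r// lerDl.
Qed.

Definition qdist (x y : 'rV[R]_N) : R := nrm (lg_mul G (lg_inv G x) y).

Lemma qdist_ge0 x y : 0 <= qdist x y. Proof. exact: qnorm_ge0. Qed.

Lemma qdistC x y : qdist x y = qdist y x.
Proof.
rewrite /qdist -[LHS]qnormV; congr (nrm _).
set c := lg_mul G (lg_inv G x) y; set b := lg_mul G (lg_inv G y) x.
have bc : lg_mul G b c = lg_one G.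
  by rewrite /b /c -lg_mulA [lg_mul G x _]lg_mulA lg_mulrV lg_mul1 lg_mulV.
by rewrite -[RHS](lg_mulr1 G) -(lg_mulrV G c) lg_mulA bc lg_mul1.
Qed.

Lemma qdist_le : exists2 K : R, 0 < K &
  forall x y z, qdist x z <= K * Num.max (qdist x y) (qdist y z).
Proof.
have [K K0 mulK] := qnormM_le; exists K => // x y z.
suff -> : qdist x z = nrm (lg_mul G (lg_mul G (lg_inv G x) y) (lg_mul G (lg_inv G y) z)).
  exact: mulK.
by rewrite -lg_mulA [lg_mul G y _]lg_mulA lg_mulrV lg_mul1.
Qed.

Lemma qdist_continuous :
  continuous (fun z : 'rV[R]_N * 'rV[R]_N => qdist z.1 z.2).
Proof.
have cinv : continuous (lg_inv G).
  move=> x; have [dinv _] := lg_inv_smooth G 1%N.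
  exact: differentiable_continuous (dinv x).
move=> z; apply: (@continuous_comp _ _ _
  (fun z => lg_mul G (lg_inv G z.1) z.2) nrm); last exact: nrm_continuous.
apply: (@continuous_comp _ _ _ (fun z => (lg_inv G z.1, z.2))
  (fun z => lg_mul G z.1 z.2)); last exact: lg_mul_continuous.
apply: (@cvg_pair _ _ _ (nbhs z) (nbhs (lg_inv G z.1)) (nbhs z.2)).
- apply: (@continuous_comp _ _ _ fst (lg_inv G)); [exact: cvg_fst|exact: cinv].
- exact: cvg_snd.
Qed.

(** By translation invariance the centre may be taken at the identity, where the quasi-ball lies in
    a box with half-sides [(r / m) ^ nu k]; the product of the [r ^ nu k] is [r ^ Q]. *)
Lemma lebesgue_rV_qball_le : exists2 A : R, 0 < A & forall x (r : R), 0 < r ->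
  (lebesgue_rV R N [set y | (qdist x y < r)%R] <=
   (A * r `^ homogeneous_dim G)%:E)%E.
Proof.
have [m m0 coordm] := qnorm_coord_le.
exists (\prod_(k < N) (2 * m^-1 `^ nu k)) => [|x r r0].
  by apply: prodr_gt0 => k _; rewrite mulr_gt0// powR_gt0// invr_gt0.
have mB : measurable [set y : 'rV[R]_N | nrm y < r].
  apply/measurable_set_bool/measurable_fun_ltr => //.
  exact: continuous_measurable_rV.
rewrite -[X in lebesgue_rV R N X]/(lg_mul G (lg_inv G x) @^-1` [set y | nrm y < r]).
rewrite lebesgue_rV_lg_mul//.
have M0 k : 0 <= (r / m) `^ nu k by exact: powR_ge0.
have mbox : measurable [set y : 'rV[R]_N | forall k, `|y ord0 k| <= (r / m) `^ nu k].
  exact: measurable_rV_box.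
apply: le_trans (le_trans (le_measure _ _ _ _) (lebesgue_rV_box_le M0)) _; rewrite ?inE//.
  move=> y /= yr k; apply: le_trans (coordm y k) _.
  apply: ge0_ler_powR; rewrite ?nnegrE ?(ltW (nu_gt0 k)) ?divr_ge0 ?qnorm_ge0 ?(ltW m0) ?(ltW r0)//.
  by rewrite ler_pM2r ?invr_gt0// ltW.
rewrite lee_fin le_eqVlt; apply/orP; left; apply/eqP.
have -> : r `^ homogeneous_dim G = \prod_(k < N) r `^ nu k.
  by rewrite /homogeneous_dim; elim/big_ind2: _ => [|a b c e <- <-|//];
    [rewrite powRr0|rewrite gt0_powRD].
rewrite -big_split/=; apply: eq_bigr => k _.
by rewrite powRM ?invr_ge0 ?(ltW m0) ?(ltW r0)// mulrAC -mulrA.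
Qed.

End quasi_norm.

(** * Morrey norms *)

Section morrey_norm.
Local Open Scope ereal_scope.
Context {R : realType} {N : nat} {G : homogeneousGroup R N} (nrm : quasiNorm G).
Implicit Types (u : 'rV[R]_N -> \bar R) (p q lam gamma W : R).

(** Taking [p]-th roots is monotone and invertible on [[0, +oo]], so a bound on the norm amounts to
    a bound on each quasi-ball, the form used by the potential estimates. *)
Lemma morrey_norm_leP p lam u W : (0 < p)%R -> (0 <= W)%R ->
  morrey_norm nrm p lam u <= W%:E <->
  (forall x (r : R), (0 < r)%R ->
    \int[lebesgue_rV R N]_(y in qball nrm x r) `|u y| `^ p <=
    (W `^ p * r `^ lam)%:E).
Proof.
move=> p0 W0; rewrite /morrey_norm; set S := ereal_sup _.
have int0 x r : 0 <= \int[lebesgue_rV R N]_(y in qball nrm x r) `|u y| `^ p.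
  by apply: integral_ge0 => y _; exact: poweR_ge0.
have S0 : 0 <= S.
  apply: le_trans (ereal_sup_ubound _); last first.
    by exists 0%R => //; exists 1%R => //=; exact: ltr01.
  by rewrite mule_ge0// lee_fin powR_ge0.
have SW : S `^ p^-1 <= W%:E <-> S <= (W `^ p)%:E.
  split=> [h|h].
    rewrite -[S]poweRe1// -(mulVf (lt0r_neq0 p0)) poweRrM -poweR_EFin.
    by apply: ge0_le_poweR; rewrite ?poweR_ge0 ?(ltW p0).
  have -> : W%:E = (W `^ p)%:E `^ p^-1.
    by rewrite poweR_EFin -powRrM mulfV ?gt_eqF// powRr1.
  by apply: ge0_le_poweR; rewrite ?invr_ge0 ?(ltW p0).
rewrite SW; split=> [h x r r0|h].
  have : (r `^ (- lam))%:E * \int[lebesgue_rV R N]_(y in qball nrm x r) `|u y| `^ p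
      <= (W `^ p)%:E.
    by apply: le_trans h; apply: ereal_sup_ubound; exists x => //; exists r.
  by rewrite powRN lee_pdivrMl ?powR_gt0// -EFinM mulrC.
apply: ge_ereal_sup => _ [x _ [r /= r0 <-]].
rewrite powRN lee_pdivrMl ?powR_gt0// -EFinM mulrC; exact: h.
Qed.

(** [u] has no sign, so Tonelli's theorem is applied to the positive and negative parts of the
    integrand separately. *)
Lemma measurable_riesz_potential gamma u : measurable_fun setT u ->
  measurable_fun setT (riesz_potential nrm gamma u).
Proof.
move=> mu.
pose F (z : 'rV[R]_N * 'rV[R]_N) :=
  ((nrm (lg_mul G (lg_inv G z.2) z.1)) `^ (gamma - homogeneous_dim G))%:E * u z.2.
have mF : measurable_fun setT F.
  apply: emeasurable_funM; last exact: (measurableT_comp mu measurable_snd).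
  apply/measurable_EFinP; apply: (measurableT_comp (measurable_powR _)).
  rewrite (_ : (fun _ => _) = (fun z => qdist nrm z.1 z.2)); last first.
    by apply/funext => z; rewrite qdistC.
  by apply: continuous_measurable_rV2; exact: qdist_continuous.
have -> : riesz_potential nrm gamma u = fun x =>
    fubini_F (lebesgue_rV R N) F^\+ x - fubini_F (lebesgue_rV R N) F^\- x.
  apply/funext => x; rewrite /riesz_potential integralE.
  by congr (_ - _); apply: eq_integral => y _; rewrite ?funeposE ?funenegE.
apply: emeasurable_funB; apply: measurable_fun_fubini_tonelli_F => //.
- exact: measurable_funepos.
- exact: measurable_funeneg.
Qed.

(** Carries bounds on quasi-balls over to compact sets, for local integrability; the radius is the
    maximum of [qdist nrm x] on [K] plus 1. *)
Lemma compact_qdist_bounded (K : set 'rV[R]_N) x : compact K ->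
  exists2 r : R, (0 < r)%R & K `<=` qball nrm x r.
Proof.
move=> cK.
have [->|/set0P K0] := eqVneq K set0; first by exists 1%R.
have cq : continuous (qdist nrm x).
  move=> y; apply: (@continuous_comp _ _ _ (fun y => (x, y))
    (fun z : 'rV[R]_N * 'rV[R]_N => qdist nrm z.1 z.2)).
    exact: (@cvg_pair _ _ _ (nbhs y) (nbhs x) (nbhs y) _ _ _ (fun=> x) id
      (@cvg_cst _ _ _ _ _) cvg_id).
  exact: qdist_continuous.
have [c _ cmax] := EVT_max_rV K0 cK (continuous_subspaceT cq).
exists (qdist nrm x c + 1)%R; first by rewrite ltr_wpDl// qdist_ge0.
move=> y Ky; rewrite /qball/= -/(qdist nrm x y) (le_lt_trans (cmax _ _)) ?inE//.
by rewrite ltrDl.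
Qed.

End morrey_norm.

Theorem theorem3p2 (R : realType) (N : nat) (G : homogeneousGroup R N)
    (nrm : quasiNorm G) (gamma p q lam : R)
    (gamma_gt0 : 0 < gamma) (gamma_ltQ : gamma < homogeneous_dim G)
    (p_gt1 : 1 < p) (p_lt : p < homogeneous_dim G / gamma)
    (p_lt_q : p < q)
    (lam_gt0 : 0 < lam) (lam_lt : lam < homogeneous_dim G - gamma * p)
    (q_eq : 1 / q = 1 / p - gamma / (homogeneous_dim G - lam)) :
  exists C : R, 0 < C /\
    forall u : 'rV[R]_N -> \bar R, morrey nrm p lam u ->
      morrey nrm q lam (riesz_potential nrm gamma u) /\
      (morrey_norm nrm q lam (riesz_potential nrm gamma u) <=
         C%:E * morrey_norm nrm p lam u)%E.
Proof.
have p0 : 0 < p by lra.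
have q0 : 0 < q by lra.
have [A A0 ball_le] := lebesgue_rV_qball_le nrm.
have [K K0 quasi] := qdist_le nrm.
have mdist : measurable_fun setT (fun z : 'rV[R]_N * 'rV[R]_N => qdist nrm z.1 z.2).
  by apply: continuous_measurable_rV2; exact: qdist_continuous.
pose mu := lebesgue_rV R N; pose Q := homogeneous_dim G.
pose C0 := morrey_cst A Q gamma p q lam K.
have C00 : 0 <= C0 by exact: morrey_cst_ge0.
(* [C0] bounds [q]-th powers, hence the root; adding 1 makes [C] positive even if [C0 = 0]. *)
pose C := C0 `^ q^-1 + 1.
have C_gt0 : 0 < C by rewrite ltr_wpDl ?powR_ge0.
exists C; split => // u [[mu_ u_loc] u_fin].
have mI := measurable_riesz_potential nrm gamma mu_.
(* The estimates require [W > 0] while the norm of [u] may be 0, so the bound is first proved for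
   every positive [W] above the norm. *)
have bound (W : R) : 0 < W -> (morrey_norm nrm p lam u <= W%:E)%E ->
    (morrey_norm nrm q lam (riesz_potential nrm gamma u) <= (C * W)%:E)%E.
  move=> W0 /(morrey_norm_leP _ _ _ p0 (ltW W0)) uW.
  have mau : measurable_fun setT (fun y => `|u y|)%E.
    exact: (measurableT_comp (@abse_measurable _ _)).
  have := morrey_potential_le mdist (qdist_ge0 nrm) (qdistC nrm) ball_le A0
    gamma_gt0 gamma_ltQ p_gt1 p_lt_q lam_gt0 lam_lt q_eq K0 quasi W0 mau
    (fun y => abse_ge0 (u y)) uW.
  move=> potW; apply/morrey_norm_leP => // [|x r r0].
    by rewrite mulr_ge0 ?ltW.
  have mB : measurable (qball nrm x r) by exact: measurable_ball mdist x r.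
  apply: (@le_trans _ _ (\int[mu]_(y in qball nrm x r)
      potential mu (qdist nrm) Q gamma (fun y => `|u y|)%E y `^ q)%E).
    apply: ge0_le_integral => //.
    - by move=> y _; exact: poweR_ge0.
    - apply: measurable_funTS; apply: (measurableT_comp (measurable_poweR q)).
      exact: (measurableT_comp (@abse_measurable _ _)).
    - apply: measurable_funTS; apply: (measurableT_comp (measurable_poweR q)).
      exact: measurable_potential.
    (* The potential of [u] is at most that of [|u|] in absolute value, which reduces to nonnegative
       functions. *)
    - move=> y _; apply: ge0_le_poweR => //; first exact: ltW.
      apply: le_trans (le_abse_integral _ _ _) _ => //.
        apply: emeasurable_funM => //; apply/measurable_EFinP.
        apply: (measurableT_comp (measurable_powR _)).
        rewrite (_ : (fun _ => _) = qdist nrm y); last first.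
          by apply/funext => z; rewrite qdistC.
        exact: (measurableT_comp mdist (pair1_measurable y)).
      rewrite le_eqVlt; apply/orP; left; apply/eqP; apply: eq_integral => z _.
      by rewrite abseM gee0_abs ?lee_fin ?powR_ge0// -/(qdist nrm z y) qdistC.
  apply: le_trans (potW x r r0) _; rewrite lee_fin.
  apply: ler_wpM2r; first exact: powR_ge0.
  rewrite powRM ?(ltW C_gt0) ?(ltW W0)//; apply: ler_wpM2r; first exact: powR_ge0.
  rewrite -[leLHS]powRr1// -[X in _ `^ X](mulVf (lt0r_neq0 q0)) powRrM.
  by apply: ge0_ler_powR; rewrite ?nnegrE ?powR_ge0 ?(ltW q0) ?(ltW C_gt0)// lerDl.
have n0 : (0 <= morrey_norm nrm p lam u)%E by exact: poweR_ge0.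
have nfin : morrey_norm nrm p lam u \is a fin_num by rewrite ge0_fin_numE.
have norm_le : (morrey_norm nrm q lam (riesz_potential nrm gamma u) <=
    C%:E * morrey_norm nrm p lam u)%E.
  move: n0 bound; rewrite -(fineK nfin); set n := fine _.
  rewrite lee_fin => n0 bound.
  (* Take [W = n + e / C] and let [e] tend to 0. *)
  apply/lee_addgt0Pr => e e0; rewrite -EFinM -EFinD.
  have -> : C * n + e = C * (n + e / C) by field; rewrite gt_eqF.
  by apply: bound; rewrite ?lee_fin ?ltr_wpDl ?lerDl ?divr_ge0 ?divr_gt0 ?(ltW C_gt0) ?(ltW e0).
have Ifin : (morrey_norm nrm q lam (riesz_potential nrm gamma u) < +oo)%E.
  by apply: le_lt_trans norm_le _; rewrite -(fineK nfin) -EFinM ltry.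
split; last exact: norm_le.
split; last exact: Ifin.
split; first exact: mI.
move=> L cL.
(* Local integrability: a compact set lies in a quasi-ball, where the finite Morrey norm bounds the
   integral. *)
have [r r0 Lr] := compact_qdist_bounded nrm 0 cL.
have mL : measurable L.
  rewrite -[L]setCK; apply: measurableC; apply: open_measurable_rV.
  by apply: closed_openC; apply: compact_closed cL; exact: norm_hausdorff.
have mB : measurable (qball nrm 0 r) by exact: measurable_ball mdist 0 r.
have mIq : measurable_fun setT (fun y => `|riesz_potential nrm gamma u y| `^ q)%E.
  apply: (measurableT_comp (measurable_poweR q)).
  exact: (measurableT_comp (@abse_measurable _ _)).
apply: (@le_lt_trans _ _ (\int[lebesgue_rV R N]_(y in qball nrm 0 r)
    `|riesz_potential nrm gamma u y| `^ q)%E).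
  apply: ge0_subset_integral => //; first exact: measurable_funTS.
  by move=> y _; exact: poweR_ge0.
have I0 : (0 <= morrey_norm nrm q lam (riesz_potential nrm gamma u))%E.
  exact: poweR_ge0.
have If : morrey_norm nrm q lam (riesz_potential nrm gamma u) \is a fin_num.
  by rewrite ge0_fin_numE.
have := lexx (morrey_norm nrm q lam (riesz_potential nrm gamma u)).
rewrite -{2}(fineK If) => /(morrey_norm_leP _ _ _ q0 (fine_ge0 I0)) /(_ 0 r r0).
by move=> /le_lt_trans; apply; exact: ltry.
Qed.
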